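(* Let $A=[\omega_{ij}]$ be a real symmetric $n\times n$ matrix with zero diagonal. Then $$(\mu_1(L_A),\ldots,\mu_{n-1}(L_A))\prec(d_1^{*},\ldots,d_{n-1}^{*}).$$
   Context: For a real symmetric $n\times n$ matrix $A=[\omega_{ij}]$ with zero diagonal, the Laplacian matrix is $L_A=D-A$, where $D$ is the diagonal matrix with $d_{ii}=\sum_{j=1}^n\omega_{ij}$. The all-ones vector $\boldsymbol{j}_n$ is an eigenvector of $L_A$ with eigenvalue $0$; $\mu_1(L_A)\ge\cdots\ge\mu_{n-1}(L_A)$ denote the remaining $n-1$ eigenvalues of $L_A$ (with multiplicity), i.e. the eigenvalues of $L_A$ restricted to the orthogonal complement $\boldsymbol{j}_n^{\perp}$, in decreasing order. (Entries may be negative, so some $\mu_i$ may be negative.) For each $i\in[n]=\{1,\ldots,n\}$, let $\omega_{\downarrow i1}\ge\omega_{\downarrow i2}\ge\cdots\ge\omega_{\downarrow i(n-1)}$ be the off-diagonal entries $(\omega_{ij})_{j\ne i}$ of row $i$ in decreasing order. The conjugate of the weighted degree sequence is defined by $d_j^{*}=\sum_{i=1}^n\omega_{\downarrow ij}$ for $j\in[n-1]$. For $\boldsymbol{x},\boldsymbol{y}\in\mathbb{R}^{p}$, $\boldsymbol{x}\prec\boldsymbol{y}$ means $\sum_{i=1}^k x_{\downarrow i}\le\sum_{i=1}^k y_{\downarrow i}$ for $k=1,\ldots,p-1$ and $\sum_{i=1}^p x_{\downarrow i}=\sum_{i=1}^p y_{\downarrow i}$, where $x_{\downarrow1}\ge\cdots\ge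 x_{\downarrow p}$ are the coordinates of $\boldsymbol{x}$ in decreasing order. *)

(* Defs.v *)
From mathcomp Require Import all_boot all_order all_algebra.
From mathcomp Require Import polyrcf.
From mathcomp Require Import reals.

Set Implicit Arguments.
Unset Strict Implicit.
Unset Printing Implicit Defensive.

Import Order.TTheory GRing.Theory Num.Theory.
Local Open Scope ring_scope.

Section Definitions.
Variable R : realType.

Definition decreasing_seq (s : seq R) : seq R := sort >=%R s.

(* The size condition says that both vectors live in the same R^p. *)
Definition majorized (x y : seq R) : Prop :=
  [/\ size x = size y,
      forall k : nat, (0 < k < size x)%N ->
        \sum_(i < k) (decreasing_seq x)`_i
          <= \sum_(i < k) (decreasing_seq y)`_i
    & \sum_(i < size x) (decreasing_seq x)`_i
        = \sum_(i < size y) (decreasing_seq y)`_i].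

(* [rootsR p] lists every real root of a nonzero p once; each root is repeated
   according to its multiplicity. *)
Definition eigenvalues (m : nat) (M : 'M[R]_m) : seq R :=
  decreasing_seq
    (flatten [seq nseq (mup a (char_poly M)) a | a <- rootsR (char_poly M)]).

Definition laplacian (n : nat) (A : 'M[R]_n) : 'M[R]_n :=
  diag_mx (\row_i \sum_j A i j) - A.

(* The row space of this matrix is the orthogonal complement of the all-ones
   vector, see [ones_orthP]. *)
Definition ones_orth (n : nat) : 'M[R]_n := kermx (const_mx 1 : 'cV[R]_n).

(* Matrices act on row vectors, so [restrictmx V L] represents the restriction
   of u |-> u *m L to the row space of V. As L is symmetric here, this is the
   usual action on column vectors. *)
Definition laplacian_eigenvalues (n : nat) (A : 'M[R]_n) : seq R :=
  eigenvalues (restrictmx (ones_orth n) (laplacian A)).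

Definition decreasing_row (n : nat) (A : 'M[R]_n) (i : 'I_n) : seq R :=
  decreasing_seq [seq A i j | j in predC1 i].

(* Indices are shifted by one: the entry at position k is d^*_(k+1). *)
Definition conjugate_degrees (n : nat) (A : 'M[R]_n) : seq R :=
  mkseq (fun k => \sum_i (decreasing_row A i)`_k) n.-1.

Lemma count_eigenvalues (m : nat) (M : 'M[R]_m) (a : R) :
  count_mem a (eigenvalues M) = mup a (char_poly M).
Proof.
have p0 : char_poly M != 0 by rewrite monic_neq0 // char_poly_monic.
rewrite /eigenvalues (permP (permEl (perm_sort _ _))) count_flatten -map_comp.
rewrite sumnE big_map (eq_bigr (fun b => (b == a) * mup b (char_poly M))%N);
  last by move=> b _; rewrite /= count_nseq.
have [/[dup] aroot ain|aN] := boolP (a \in rootsR (char_poly M)).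
  rewrite (bigD1_seq a) ?uniq_roots //= eqxx mul1n big1 ?addn0 // => b.
  by move=> /negPf ->.
rewrite big1_seq => [|b /= bin]; last first.
  by case: eqP => // ba; rewrite -ba bin in aN.
apply/esym/eqP; rewrite -leqn0 leqNgt mup_geq // expr1 dvdp_XsubCl.
apply: contra aN => ra.
by rewrite in_roots ra p0 andbT /= -[_ \in _]/(_ \in _) root_in_cauchy_bound.
Qed.

Lemma ones_orthP (n : nat) (u : 'rV[R]_n) :
  (u <= ones_orth n)%MS = (\sum_i u 0 i == 0).
Proof.
have -> : \sum_i u 0 i = (u *m const_mx 1 : 'M_1) 0 0.
  by rewrite mxE; apply: eq_bigr => i _; rewrite mxE mulr1.
apply/sub_kermxP/eqP => [->|h]; first by rewrite mxE.
by apply/matrixP => i j; rewrite !ord1 h mxE.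
Qed.

Lemma laplacian_ones (n : nat) (A : 'M[R]_n) :
  laplacian A *m (const_mx 1 : 'cV_n) = 0.
Proof.
apply/matrixP => i j; rewrite mulmxBl mul_diag_mx !mxE mulr1.
rewrite -sumrB; apply: big1 => k _.
by rewrite mxE mulr1 subrr.
Qed.

Lemma ones_orth_stable (n : nat) (A : 'M[R]_n) :
  stablemx (ones_orth n) (laplacian A).
Proof. by apply/sub_kermxP; rewrite -mulmxA laplacian_ones mulmx0. Qed.

End Definitions.

Arguments ones_orth R n : clear implicits.

(* Main.v *)
Require Import Defs.
From mathcomp Require Import all_boot all_order all_algebra.
From mathcomp Require Import complex.
From mathcomp Require Import all_classical reals topology normedtype.
(* Not imported: its keyword [decreasing_seq] hides the definition of that name *)
From mathcomp Require sequences.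
From mathcomp Require Import ring lra.

(* Ky Fan: a sum of k eigenvalues is [\tr (L_A Q)] for an orthogonal
   projection [Q] of rank k whose kernel contains the all-ones vector, and this
   is linear in [A].  So is the right-hand side on matrices whose entries are
   ordered in the same way, hence peeling off the smallest entries reduces the
   claim to graphs (the Grone-Merris conjecture, proved by Bai).

   In a graph, joining all vertices of degree at least k by edges and deleting
   the edges between vertices of degree less than k reduces the claim to a split
   graph: a clique H of N vertices, an independent set, and a bipartite weight
   [a] between them.  There one needs [\tr ((L - N) Q) <= \sum a].  By linearity
   [a] may be assumed to take its values in ]0, 1[; put [b = 1 - a] on
   H x (complement of H).  On vectors with zero sum [L - N] acts as
   [T = D - E + b^T - a], where [D], [E] are the row sums of [a] and the column
   sums of [b].  The Riccati equation [a + y b^T y = D y + y E] has a nonnegative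
   solution with row sums at most 1, the limit of a monotone iteration, and [y]
   block-triangularizes [T].  One diagonal block, [b^T y - E], has no positive
   eigenvalue; the other, [D - y b^T], is an M-matrix, so its trace, which is at
   most [\sum a], bounds the sum of the positive eigenvalues of [L - N]. *)

Set Implicit Arguments.
Unset Strict Implicit.
Unset Printing Implicit Defensive.

Import Order.TTheory GRing.Theory Num.Theory numFieldNormedType.Exports.
Local Open Scope ring_scope.

(** * Real symmetric matrices *)

Section Spectral.
Variable R : rcfType.

Lemma row_sqr_ge0 n (u : 'rV[R]_n) : 0 <= (u *m u^T) 0 0.
Proof. by rewrite mxE sumr_ge0 // => i _; rewrite mxE -expr2 sqr_ge0. Qed.

Lemma row_sqr_eq0 n (u : 'rV[R]_n) : ((u *m u^T) 0 0 == 0) = (u == 0).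
Proof.
apply/eqP/eqP => [|->]; last by rewrite mul0mx mxE.
rewrite mxE => /eqP; rewrite psumr_eq0; last first.
  by move=> i _; rewrite mxE -expr2 sqr_ge0.
move=> /allP u0; apply/rowP => i; rewrite mxE.
by have /(_ (mem_index_enum i)) := u0 i; rewrite mxE mulf_eq0 orbb => /eqP.
Qed.

Lemma orthogonal_extension n (v : 'rV[R]_n.+1) :
  v *m v^T = 1%:M -> exists2 O : 'M[R]_n.+1, O *m O^T = 1%:M & row 0 O = v.
Proof.
move=> v1; pose e : 'rV[R]_n.+1 := delta_mx 0 0.
have [w defw] : {w | w = v - e} by exists (v - e).
have [w0|w0] := eqVneq w 0.
  exists 1%:M; first by rewrite trmx1 mulmx1.
  by rewrite row1; apply/esym/eqP; rewrite -subr_eq0 -defw w0.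
have ee : e *m e^T = 1%:M.
  by rewrite trmx_delta mul_delta_mx; apply/matrixP => i j; rewrite !ord1 !mxE.
pose c := (w *m w^T) 0 0.
have c0 : c != 0 by rewrite row_sqr_eq0.
have wE : w *m w^T = c%:M by rewrite [LHS]mx11_scalar.
(* Householder reflection exchanging [e] and [v] *)
pose O := 1%:M - (2 / c) *: (w^T *m w).
have OT : O^T = O by rewrite /O linearB linearZ /= trmx1 trmx_mul trmxK.
have ww : (w^T *m w) *m (w^T *m w) = c *: (w^T *m w).
  by rewrite mulmxA -(mulmxA w^T) wE mul_mx_scalar -scalemxAl.
exists O.
  rewrite OT /O mulmxBl mul1mx mulmxBr mulmx1 -scalemxAl -scalemxAr ww !scalerA.
  apply/matrixP => i j; rewrite !mxE; set t := \sum_(_ < _) _; field.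
  exact: c0.
(* As [e] and [v] are unit vectors, c = |v - e|^2 = 2 - 2<e,v>. Hence <e,w> = -c/2, and the
   reflection sends [e] to [e + w = v]. *)
have ew : e *m w^T = (- (c / 2))%:M.
  have ev : v *m e^T = e *m v^T.
    apply/matrixP => i j; rewrite !ord1 !mxE.
    by apply: eq_bigr => k _; rewrite !mxE mulrC.
  have cE : c%:M = 2%:M - 2 *: (e *m v^T) :> 'M_1.
    rewrite -wE defw linearB /= mulmxBl !mulmxBr v1 ee ev.
    apply/matrixP => i j; rewrite !ord1 !mxE; set t := \sum_(_ < _) _.
    by rewrite !mulr1n; ring.
  have := congr1 (fun M : 'M_1 => M 0 0) cE; rewrite /= !mxE !mulr1n => cE0.
  rewrite defw linearB /= mulmxBr ee; apply/matrixP => i j; rewrite !ord1 !mxE.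
  by rewrite cE0 !mulr1n; set t := \sum_(_ < _) _; field.
rewrite rowE -/e /O mulmxBr mulmx1 -scalemxAr mulmxA ew mul_scalar_mx scalerA.
have -> : 2 / c * - (c / 2) = -1 by field.
by rewrite scaleN1r opprK defw addrC subrK.
Qed.

Local Notation C := (complex R).
Local Notation toC := (map_mx (real_complex R)).

(** An eigenvalue exists over the complex numbers. It is real because the Hermitian form of [M] at
    its eigenvector can be evaluated from either side, and as a root of the characteristic
    polynomial it descends to [R]. *)
Lemma symmetric_eigenvalue n (M : 'M[R]_n.+1) :
  M^T = M -> exists r, eigenvalue M r.
Proof.
move=> Msym.
have [z] := @eigenvalue_closed C _ (toC M) isT.
move=> /eigenvalueP [x xM x0].
have zr : z \is Num.real.
  rewrite CrealE.
  have E1 : x *m toC M *m (map_mx Num.conj x)^T = z *: (x *m (map_mx Num.conj x)^T).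
    by rewrite xM -scalemxAl.
  have E2 : x *m toC M *m (map_mx Num.conj x)^T
      = (Num.conj z) *: (x *m (map_mx Num.conj x)^T).
    rewrite -mulmxA.
    have -> : toC M *m (map_mx Num.conj x)^T = (map_mx Num.conj (x *m toC M))^T.
      rewrite map_mxM trmx_mul; congr (_ *m _).
      apply/matrixP => i j; rewrite !mxE -[in LHS]Msym mxE.
      by apply/esym/conj_Creal/complex_realP; exists (M j i).
    rewrite xM; apply/matrixP => i j; rewrite !ord1 !mxE mulr_sumr.
    by apply: eq_bigr => k _; rewrite !mxE rmorphM /=; ring.
  have := congr1 (fun M : 'M_1 => M 0 0) (etrans (esym E1) E2).
  rewrite /= [LHS]mxE [RHS]mxE => /mulIf <- //.
  rewrite mxE psumr_neq0; last by move=> i _; rewrite !mxE mul_conjC_ge0.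
  have [i xi] : exists i, x 0 i != 0.
    apply/existsP; apply: contraNT x0; rewrite negb_exists => /forallP H.
    by apply/eqP/rowP => i; rewrite mxE; apply/eqP; have := H i; rewrite negbK.
  apply/hasP; exists i; first exact: mem_index_enum.
  by rewrite !mxE mul_conjC_gt0.
have [r zE] := complex_realP _ zr.
exists r; rewrite eigenvalue_root_char -(fmorph_root (real_complex R)).
rewrite map_char_poly -eigenvalue_root_char; apply/eigenvalueP.
by exists x => //; rewrite xM zE.
Qed.

(** Deflation: in an orthonormal basis starting with a unit eigenvector, symmetry makes [M] block
    diagonal, and induction applies to the lower right block. The rows of [P] are the
    eigenvectors. *)
Theorem symmetric_spectral n (M : 'M[R]_n) : M^T = M ->
  exists (P : 'M[R]_n) (d : 'rV[R]_n),
    P *m P^T = 1%:M /\ P *m M = diag_mx d *m P.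
Proof.
elim: n M => [|n IHn] M Msym.
  by exists 1%:M, 0; split; apply/matrixP => -[].
have [r /eigenvalueP [u uM u0]] := symmetric_eigenvalue Msym.
pose s := Num.sqrt ((u *m u^T) 0 0).
have s0 : s != 0 by rewrite sqrtr_eq0 -ltNge lt_def row_sqr_eq0 u0 row_sqr_ge0.
pose v := s^-1 *: u.
have v1 : v *m v^T = 1%:M.
  rewrite /v linearZ /= -scalemxAl -scalemxAr scalerA [u *m u^T]mx11_scalar.
  rewrite -(sqr_sqrtr (row_sqr_ge0 u)) -/s scale_scalar_mx; congr (_%:M); field.
  exact: s0.
have vM : v *m M = r *: v by rewrite /v -scalemxAl uM !scalerA mulrC.
have [O OO rO] := orthogonal_extension v1.
have OtO : O^T *m O = 1%:M by apply: mulmx1C.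
have [N defN] : {N : 'M[R]_(1 + n) | N = O *m M *m O^T} by exists (O *m M *m O^T).
have Nsym : N^T = N by rewrite defN !trmx_mul trmxK Msym mulmxA.
have rN : row 0 N = r *: delta_mx 0 0.
  rewrite defN !row_mul rO vM -scalemxAl; congr (_ *: _).
  have -> : v = delta_mx 0 0 *m O by rewrite -rowE rO.
  by rewrite -mulmxA OO mulmx1.
have N0 (j : 'I_(1 + n)) : N 0 j = r * (j == 0)%:R.
  by have := congr1 (fun M : 'rV_(1 + n) => M 0 j) rN; rewrite /= !mxE.
have NE : N = block_mx r%:M 0 0 (drsubmx N).
  rewrite -[LHS]submxK.
  have ul : ulsubmx N = r%:M.
    apply/matrixP => i j; rewrite !ord1 !mxE !mulr1n.
    by rewrite (_ : lshift n 0 = 0) ?N0 ?mulr1 //; apply/val_inj.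
  have ur : ursubmx N = 0.
    apply/matrixP => i j; rewrite !ord1 !mxE.
    by rewrite (_ : lshift n 0 = 0) ?N0 ?mulr0 //; apply/val_inj.
  have dl : dlsubmx N = 0.
    by rewrite -Nsym -trmx_ursub ur trmx0.
  by rewrite ul ur dl.
have [|P' [d' [P1 P2]]] := IHn (drsubmx N).
  by rewrite trmx_drsub Nsym.
pose B : 'M[R]_(1 + n) := block_mx 1%:M 0 0 P'.
have BB : B *m B^T = 1%:M.
  rewrite /B tr_block_mx !trmx0 trmx1 mulmx_block.
  by rewrite !mulmx0 !mul0mx mulmx1 P1 !addr0 add0r -scalar_mx_block.
exists (B *m O), (row_mx r%:M d'); split.
  by rewrite trmx_mul mulmxA -(mulmxA B) OO mulmx1.
have OM : O *m M = N *m O by rewrite defN -!mulmxA OtO mulmx1.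
rewrite -mulmxA OM !mulmxA; congr (_ *m _).
have BN : B *m N = block_mx r%:M 0 0 (diag_mx d') *m B :> 'M_(1 + n).
  rewrite NE /B !mulmx_block !mulmx0 !mul0mx !addr0 !add0r P2 mulmx1 mul1mx.
  by [].
have dE : diag_mx (row_mx r%:M d') = block_mx r%:M 0 0 (diag_mx d') :> 'M_(1 + n).
  rewrite diag_mx_row; congr (block_mx _ _ _ _).
  by apply/matrixP => i j; rewrite !ord1 !mxE.
by rewrite [LHS]BN -dE.
Qed.

End Spectral.

(** * M-matrices *)

Section MMatrix.
Variable R : rcfType.
Local Notation C := (complex R).
Local Notation toC := (map_mx (real_complex R)).
Local Notation Re := (@complex.Re R).

Lemma trace_eigenvalues_ge0 n (M : 'M[C]_n) :
  (forall z, eigenvalue M z -> 0 <= Re z) -> 0 <= Re (\tr M).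
Proof.
case: n M => [|n] M Mge0; first by rewrite /mxtrace big_ord0.
have [s sE] := closed_field_poly_normal (char_poly M).
rewrite (monicP (char_poly_monic M)) scale1r in sE.
have sz : size s = n.+1.
  by have := size_char_poly M; rewrite sE size_prod_XsubC => -[].
have trE : \tr M = \sum_(z <- s) z.
  apply: oppr_inj; rewrite -char_poly_trace // sE -sz coefPn_prod_XsubC //.
  by rewrite sz.
rewrite trE (raddf_sum (Re : Rcomplex R -> R)).
rewrite big_seq sumr_ge0 // => z zs; apply: Mge0.
by rewrite eigenvalue_root_char sE root_prod_XsubC.
Qed.

(** Take moduli in the eigenvector equation, isolate the diagonal term, and sum with weights [v]: as
    [v *m b] is nonnegative, the weighted sum of (|z - b_ii| - b_ii)|w_i| is at most 0. If Re z < 0,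
    all these coefficients are positive, so [w] vanishes. *)
Lemma Mmatrix_eigenvalue n (b : 'M[R]_n) (v : 'rV[R]_n) (w : 'rV[C]_n) z :
    (forall i j, i != j -> b i j <= 0) -> (forall i, 0 < v 0 i) ->
    (forall j, 0 <= (v *m b) 0 j) ->
    w != 0 -> w *m (toC b)^T = z *: w -> 0 <= Re z.
Proof.
move=> bneg vpos vb w0 wb; rewrite leNgt; apply/negP => z0.
pose V i : C := (v 0 i)%:C%C; pose B i j : C := (b i j)%:C%C.
have Vge0 i : 0 <= V i by rewrite ler0c ltW.
have Bge0 i j : i != j -> 0 <= - B i j.
  by move=> ij; rewrite -rmorphN /= ler0c oppr_ge0 bneg.
have E i : `|z - B i i| * `|w 0 i| <= \sum_(j | j != i) - B i j * `|w 0 j|.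
  have -> : `|z - B i i| * `|w 0 i| = `|\sum_(j | j != i) B i j * w 0 j|.
    rewrite -normrM mulrBl; congr `|_|.
    have := congr1 (fun M : 'rV_n => M 0 i) wb; rewrite /= !mxE => <-.
    rewrite (bigD1 i) //= !mxE [w 0 i * _]mulrC addrAC subrr add0r.
    by apply: eq_bigr => j _; rewrite !mxE mulrC.
  apply: le_trans (ler_norm_sum _ _ _) _; apply: ler_sum => j ji.
  by rewrite normrM -(normrN (B i j)) (ger0_norm (Bge0 _ _ _)) // eq_sym.
have S : \sum_i V i * (`|z - B i i| * `|w 0 i|) <= \sum_i V i * B i i * `|w 0 i|.
  apply: (@le_trans _ _ (\sum_i V i * \sum_(j | j != i) - B i j * `|w 0 j|)).
    by apply: ler_sum => i _; apply: ler_wpM2l.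
  under eq_bigr do rewrite mulr_sumr.
  rewrite (exchange_big_dep predT) //=; apply: ler_sum => j _.
  have -> : \sum_(i | j != i) V i * (- B i j * `|w 0 j|)
     = (V j * B j j - ((v *m b) 0 j)%:C%C) * `|w 0 j|.
    rewrite mxE rmorph_sum /= [in RHS](bigD1 j) //= rmorphM /= opprD addrA subrr sub0r.
    rewrite -sumrN mulr_suml; apply: eq_big => [i|i _]; first by rewrite eq_sym.
    by rewrite rmorphM /= mulrA mulrN.
  by rewrite ler_wpM2r // lerBlDr lerDl ler0c.
have h i : 0 < V i * (`|z - B i i| - B i i).
  rewrite mulr_gt0 ?ltcR // subr_gt0; apply: lt_le_trans (normc_ge_Re _).
  rewrite ltcR raddfB /= -normrN; apply: lt_le_trans (ler_norm _).
  by rewrite opprB ltrDl oppr_gt0.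
have : \sum_i V i * (`|z - B i i| - B i i) * `|w 0 i| <= 0.
  move: S; rewrite -subr_le0 -sumrB; congr (_ <= 0); apply: eq_bigr => i _.
  by ring.
rewrite le_eqVlt orbC => /orP[/lt_geF/negbT/negP[]|].
  by apply: sumr_ge0 => i _; rewrite mulr_ge0 // ltW.
rewrite psumr_eq0 => [/allP H|i _]; last by rewrite mulr_ge0 // ltW.
case/negP: w0; apply/eqP/rowP => i; rewrite mxE.
have := H i (mem_index_enum i); rewrite mulf_eq0 normr_eq0 => /orP[/eqP hi|/eqP //].
by have := h i; rewrite hi ltxx.
Qed.

(* The rows of [X] span an invariant subspace of [b]; every eigenvalue of [b]
   on the quotient has nonnegative real part, hence so has the trace of [b]
   on the quotient. *)
Lemma Mmatrix_trace n (b : 'M[R]_n) (v : 'rV[R]_n) p (X : 'M[R]_(p, n)) L :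
    (forall i j, i != j -> b i j <= 0) -> (forall i, 0 < v 0 i) ->
    (forall j, 0 <= (v *m b) 0 j) ->
    row_free X -> X *m b = L *m X -> \tr L <= \tr b.
Proof.
move=> bneg vpos vb Xfree XbL.
have [r rE] : {r | n = (p + r)%N}.
  by exists (n - p)%N; rewrite subnKC // -(eqP Xfree) rank_leq_col.
subst n.
(* The rank factorization of [X] completes it to an invertible [G], whose first [p] rows are those
   of [X]. *)
pose G : 'M[R]_(p + r) := block_mx (col_ebase X) 0 0 1%:M *m row_ebase X.
have Gunit : G \in unitmx.
  rewrite unitmx_mul row_ebase_unit andbT unitmxE det_ublock det1 mulr1.
  by rewrite -unitmxE col_ebase_unit.
have GX : usubmx G = X.
  rewrite -[X in RHS]mulmx_ebase (eqP Xfree) -mul_usub_mx; congr (_ *m _).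
  by rewrite block_mxEv col_mxKu pid_mx_row mul_mx_row mulmx1 mulmx0.
clearbody G.
(* In the basis [G] the matrix [b] is block lower triangular: [L] on the invariant subspace,
   [drsubmx M] on the quotient. *)
have [M defM] : {M | M = G *m b *m invmx G} by exists (G *m b *m invmx G).
have Mu : usubmx M = row_mx L 0.
  rewrite defM -!mul_usub_mx GX XbL -GX -[RHS]mulmx1 -(mulmxV Gunit).
  by rewrite [RHS]mulmxA -[G in RHS]vsubmxK mul_row_col mul0mx addr0 vsubmxK.
have ME : M = block_mx L 0 (dlsubmx M) (drsubmx M).
  rewrite -[LHS]submxK; congr block_mx.
    by rewrite /ulsubmx Mu row_mxKl.
  by rewrite /ursubmx Mu row_mxKr.
have trM : \tr b = \tr L + \tr (drsubmx M).
  rewrite -(mxtrace_block L 0 (dlsubmx M)) -ME defM mxtrace_mulC mulmxA.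
  by rewrite mulVmx // mul1mx.
rewrite trM lerDl.
have -> : \tr (drsubmx M) = Re (\tr (toC (drsubmx M))^T).
  by rewrite mxtrace_tr trace_map_mx.
apply: trace_eigenvalues_ge0 => z /eigenvalueP [w wM w0].
(* Padded with zeros, [w] is a row eigenvector of the transpose of [M]; [w'] is the corresponding
   one for the transpose of [b]. *)
pose w' : 'rV[C]_(p + r) := row_mx 0 w *m toC (invmx G)^T.
apply: (@Mmatrix_eigenvalue _ b v w') => //.
  apply: contra w0 => /eqP /(congr1 (mulmx^~ (toC G^T))).
  rewrite /w' mul0mx -mulmxA -map_mxM -trmx_mul mulmxV // trmx1 map_mx1 mulmx1.
  by rewrite -row_mx0 => /eq_row_mx [_ ->].
have bM : b *m invmx G = invmx G *m M by rewrite defM -!mulmxA mulKmx.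
rewrite /w' -mulmxA map_trmx -map_mxM -trmx_mul bM trmx_mul map_mxM mulmxA.
rewrite scalemxAl; congr (_ *m _).
rewrite ME tr_block_mx map_block_mx mul_row_block !mul0mx !add0r.
by rewrite trmx0 map_mx0 mulmx0 -map_trmx wM scale_row_mx scaler0.
Qed.
End MMatrix.

(** * The Riccati equation *)

Section PositiveNullVector.
Variable R : realFieldType.

(* If a null vector of a Laplacian-like matrix is replaced by its absolute
   value, every entry of its image becomes nonpositive; these entries add up
   to zero, so they all vanish. *)
Lemma nonneg_null_vector n (c : 'M[R]_n.+1) : (forall i j, 0 <= c i j) ->
  exists2 u : 'I_n.+1 -> R, (forall i, 0 <= u i) /\ (exists i, u i != 0) &
    forall j, (\sum_i c j i) * u j = \sum_i u i * c i j.
Proof.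
move=> cge0; pose M := diag_mx (\row_j \sum_i c j i) - c.
have M1 : (const_mx 1 : 'rV_n.+1) *m M^T = 0.
  apply/rowP => j; rewrite !mxE.
  under eq_bigr => i _ do rewrite !mxE mul1r.
  rewrite sumrB (bigD1 j) //= eqxx [X in _ + X - _]big1 => [|i ij].
    by rewrite addr0 mulr1n subrr.
  by rewrite eq_sym (negPf ij).
(* The rows of [M] sum to zero, so [M] is singular and has a left null vector, of unknown signs. *)
have : \det M == 0.
  rewrite -det_tr; apply/det0P; exists (const_mx 1) => //.
  by apply/eqP => /rowP /(_ 0); rewrite !mxE => /eqP; rewrite oner_eq0.
case/det0P => v v0 vM.
have vE j : (\sum_i c j i) * v 0 j = \sum_i v 0 i * c i j.
  have /eqP := congr1 (fun w : 'rV_n.+1 => w 0 j) vM.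
  by rewrite /M mulmxBr mul_mx_diag !mxE subr_eq0 mulrC => /eqP.
exists (fun i => `|v 0 i|); first split => //.
  by have /rV0Pn [i vi] := v0; exists i; rewrite normr_eq0.
have rge0 j : 0 <= \sum_i c j i by apply: sumr_ge0.
have le j : 0 <= \sum_i `|v 0 i| * c i j - (\sum_i c j i) * `|v 0 j|.
  rewrite subr_ge0 -{1}(ger0_norm (rge0 j)) -normrM vE.
  apply: le_trans (ler_norm_sum _ _ _) _; apply: ler_sum => i _.
  by rewrite normrM (ger0_norm (cge0 _ _)).
have : \sum_j (\sum_i `|v 0 i| * c i j - (\sum_i c j i) * `|v 0 j|) == 0.
  rewrite sumrB exchange_big /= subr_eq0; apply/eqP; apply: eq_bigr => i _.
  by rewrite mulr_suml; apply: eq_bigr => j _; rewrite mulrC.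
rewrite psumr_eq0 // => /allP H j; apply/esym/eqP; rewrite -subr_eq0.
exact: (H j (mem_index_enum j)).
Qed.

End PositiveNullVector.

Section Riccati.
Variables (R : realType) (n : nat) (h : 'I_n.+1 -> bool) (a b : 'M[R]_n.+1).
Hypothesis a0 : forall i j, ~~ (h i && ~~ h j) -> a i j = 0.
Hypothesis b0 : forall i j, ~~ (h i && ~~ h j) -> b i j = 0.
Hypothesis apos : forall i j, h i -> ~~ h j -> 0 < a i j.
Hypothesis bpos : forall i j, h i -> ~~ h j -> 0 < b i j.

(** H is the set where [h] holds; blocks are encoded as full square matrices vanishing off H x
    complement. The row bound on [y] will exclude positive eigenvalues of b^T y - E. The two last
    conditions on [v] will give v (D - y b^T) >= 0, the M-matrix certificate. *)
Definition riccati_pair (v : 'I_n.+1 -> R) (y : 'M[R]_n.+1) :=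
  [/\ forall i, 0 < v i,
      forall i j, ~~ (h i && ~~ h j) -> y i j = 0,
      forall i j, 0 <= y i j,
      forall i, \sum_j y i j <= 1 &
      (forall i, h i -> v i * (\sum_j a i j) = \sum_j v j * b i j) /\
      (forall j, ~~ h j -> \sum_i v i * y i j <= v j)] /\
  forall i j, a i j + (y *m b^T *m y) i j
    = y i j * (\sum_l a i l + \sum_l b l j).

Let age0 i j : 0 <= a i j.
Proof.
by have [/andP[hi hj]|/a0 -> //] := boolP (h i && ~~ h j); apply/ltW/apos.
Qed.

Let bge0 i j : 0 <= b i j.
Proof.
by have [/andP[hi hj]|/b0 -> //] := boolP (h i && ~~ h j); apply/ltW/bpos.
Qed.

(** In [a + b^T] every pair separated by H has a positive entry. A zero of a nonnegative null vector
    therefore spreads to the whole other side, and from there back, which would make the vector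
    zero. *)
Lemma positive_null_vector : (exists i, h i) -> (exists i, ~~ h i) ->
  exists2 v : 'I_n.+1 -> R, (forall i, 0 < v i) &
    (forall i, h i -> v i * (\sum_j a i j) = \sum_j v j * b i j) /\
    (forall j, ~~ h j -> v j * (\sum_i b i j) = \sum_i v i * a i j).
Proof.
move=> [p hp] [q hq].
pose c := a + b^T.
have cge0 i j : 0 <= c i j by rewrite !mxE addr_ge0.
have [v [vge0 [k vk]] vc] := nonneg_null_vector cge0.
have cpos i j : h i != h j -> 0 < c i j.
  case: (boolP (h i)) => hi; case: (boolP (h j)) => hj //= _; rewrite !mxE.
    by rewrite ltr_pwDl // apos.
  by rewrite ltr_wpDl // bpos.
have v0 i : v i = 0 -> forall j, h j != h i -> v j = 0.
  move=> vi j ji; have /eqP := vc i; rewrite vi mulr0 eq_sym psumr_eq0; last first.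
    by move=> l _; rewrite mulr_ge0.
  move=> /allP /(_ j (mem_index_enum j)) /=.
  by rewrite mulf_eq0 (gt_eqF (cpos _ _ ji)) orbF => /eqP.
exists v => [i|].
  rewrite lt_def vge0 andbT; apply: contra vk => /eqP vi; apply/eqP.
  have [kE|] := boolP (h k != h i); first exact: v0 vi _ kE.
  rewrite negbK => /eqP ki.
  have [l li] : exists l, h l != h i.
    by case: (boolP (h i)) => hi; [exists q | exists p]; rewrite ?hp ?(negPf hq).
  by apply: (v0 l); [exact: v0 li | rewrite ki eq_sym].
split=> i hi; have := vc i.
  under eq_bigr => j _ do rewrite !mxE (b0 (i:=j)) ?hi ?andbF // addr0.
  rewrite mulrC => ->; apply: eq_bigr => j _.
  by rewrite !mxE (a0 (i:=j)) ?hi ?andbF // add0r.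
under eq_bigr => j _ do rewrite !mxE (a0 (i:=i)) ?(negPf hi) // add0r.
rewrite mulrC => ->; apply: eq_bigr => j _.
by rewrite !mxE (b0 (i:=i)) ?(negPf hi) // addr0.
Qed.

(** Iterating [F] from 0 gives entrywise increasing matrices bounded by 1, whose limit is a fixed
    point. The row bound and the [v]-weighted column bound hold along the iteration and pass to the
    limit. *)
Lemma riccati_solution : exists v y, riccati_pair v y.
Proof.
(* If H or its complement is empty, [a] and [b] vanish and [y = 0] works. *)
have degenerate : (forall i j, ~~ (h i && ~~ h j)) -> exists v y, riccati_pair v y.
  move=> hc; exists (fun=> 1), 0; split; last first.
    by move=> i j; rewrite a0 // mulmx0 !mxE mul0r addr0.
  split=> //; first by move=> i j _; rewrite mxE.
  - by move=> i j; rewrite mxE.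
  - by move=> i; rewrite big1 // => j _; rewrite mxE.
  split=> i _; last by rewrite big1 // => j _; rewrite mxE mulr0.
  rewrite mul1r; apply: eq_bigr => j _; by rewrite a0 ?b0 ?mulr0.
have [/existsP[p hp]|H0] := boolP [exists i, h i]; last first.
  apply: degenerate => i j; apply: contra H0 => /andP[hi _]; by apply/existsP; exists i.
have [/existsP[q hq]|L0] := boolP [exists i, ~~ h i]; last first.
  apply: degenerate => i j; apply: contra L0 => /andP[_ hj]; by apply/existsP; exists j.
have [v vpos [vH vL]] := positive_null_vector (ex_intro _ p hp) (ex_intro _ q hq).
have vge0 i : 0 <= v i by apply/ltW.
pose d i := \sum_j a i j; pose e j := \sum_i b i j.
have dge0 i : 0 <= d i by apply: sumr_ge0.
have ege0 i : 0 <= e i by apply: sumr_ge0.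
have dpos i : h i -> 0 < d i.
  by move=> hi; rewrite /d (bigD1 q) //= ltr_pwDl ?sumr_ge0 ?apos.
have epos j : ~~ h j -> 0 < e j.
  by move=> hj; rewrite /e (bigD1 p) //= ltr_pwDl ?sumr_ge0 ?bpos.
pose Q (y : 'M[R]_n.+1) := y *m b^T *m y.
have QE y i j : Q y i j = \sum_l \sum_m y i m * b l m * y l j.
  rewrite mxE; apply: eq_bigr => l _; rewrite mxE mulr_suml.
  by apply: eq_bigr => m _; rewrite mxE.
pose F y : 'M[R]_n.+1 := \matrix_(i, j) ((a i j + Q y i j) / (d i + e j)).
pose supp (y : 'M[R]_n.+1) := forall i j, ~~ (h i && ~~ h j) -> y i j = 0.
have Q0 y : supp y -> supp (Q y).
  move=> ys i j; rewrite negb_and => /orP[hi|hj].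
    rewrite QE big1 // => l _; rewrite big1 // => m _.
    by rewrite ys ?(negPf hi) // !mul0r.
  rewrite QE big1 // => l _; rewrite big1 // => m _.
  by rewrite (ys l j) ?(negPf hj) ?andbF // mulr0.
have FE y : supp y -> forall i j, F y i j * (d i + e j) = a i j + Q y i j.
  move=> ys i j; rewrite mxE.
  have [/andP[hi hj]|hij] := boolP (h i && ~~ h j).
    by rewrite mulfVK // gt_eqF // ltr_pwDl // dpos.
  by rewrite a0 // Q0 // addr0 !mul0r.
pose nng (y : 'M[R]_n.+1) := forall i j, 0 <= y i j.
pose leM (x y : 'M[R]_n.+1) := forall i j, x i j <= y i j.
pose good (y : 'M[R]_n.+1) := [/\ supp y, nng y, leM y (F y),
  forall i, \sum_j y i j <= 1 & forall j, ~~ h j -> \sum_i v i * y i j <= v j].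
have Fmono x y : nng x -> leM x y -> leM (F x) (F y).
  move=> x0 xy i j; rewrite ![F _ _ _]mxE !QE ler_wpM2r ?invr_ge0 ?addr_ge0 // lerD2l.
  apply: ler_sum => l _; apply: ler_sum => m _.
  by rewrite ler_pM ?mulr_ge0 // ler_wpM2r.
have goodF y : good y -> good (F y).
  move=> [ys y0 yF y1 yv].
  have ysF : supp (F y) by move=> i j hij; rewrite mxE a0 // Q0 // addr0 mul0r.
  split=> //.
  - by move=> i j; apply: le_trans (yF i j).
  - exact: Fmono.
  - move=> i; have [hi|hi] := boolP (h i); last first.
      by rewrite big1 // => j _; rewrite ysF ?(negPf hi).
    (* Sum the equation defining [F y] over [j]: by the row bound the quadratic terms add up to at
       most sum_j y_ij e_j, hence to at most sum_j (F y)_ij e_j. *)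
    have : d i * \sum_j F y i j <= d i * 1.
      rewrite mulr1 -subr_le0.
      have -> : d i * (\sum_j F y i j) - d i = \sum_j Q y i j - \sum_j F y i j * e j.
        rewrite /d -[X in _ - X = _]/(\sum_j a i j) mulr_sumr -!sumrB.
        by apply: eq_bigr => j _; have := FE y ys i j; rewrite -/(d i); lra.
      rewrite subr_le0; apply: (@le_trans _ _ (\sum_j y i j * e j)); last first.
        by apply: ler_sum => j _; rewrite ler_wpM2r.
      under eq_bigr do rewrite QE.
      rewrite exchange_big /=.
      under [leRHS]eq_bigr do rewrite /e mulr_sumr.
      rewrite [leRHS]exchange_big /=; apply: ler_sum => l _.
      rewrite exchange_big /=; apply: ler_sum => m _.
      by rewrite -mulr_sumr ler_piMr // mulr_ge0.
    by rewrite ler_pM2l // dpos.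
  - move=> j hj.
    (* The same argument on column [j], weighted by [v]: the column bound and [vH] give sum_i v_i
       Q_ij <= sum_i v_i y_ij d_i. *)
    have : (\sum_i v i * F y i j) * e j <= v j * e j.
      rewrite (vL _ hj) -subr_le0.
      have -> : (\sum_i v i * F y i j) * e j - \sum_i v i * a i j
         = \sum_i v i * Q y i j - \sum_i v i * (F y i j * d i).
        rewrite mulr_suml -!sumrB.
        by apply: eq_bigr => i _; have := FE y ys i j; nra.
      rewrite subr_le0; apply: (@le_trans _ _ (\sum_i v i * (y i j * d i))); last first.
        by apply: ler_sum => i _; rewrite ler_wpM2l // ler_wpM2r.
      have -> : \sum_i v i * (y i j * d i) = \sum_i (\sum_l v l * b i l) * y i j.
        apply: eq_bigr => i _; have [hi|hi] := boolP (h i).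
          by rewrite -vH // -/(d i); ring.
        by rewrite ys ?(negPf hi) // mul0r !mulr0.
      under eq_bigr do rewrite QE mulr_sumr.
      rewrite exchange_big /=; apply: ler_sum => l _.
      under eq_bigr do rewrite mulr_sumr.
      rewrite exchange_big /= mulr_suml; apply: ler_sum => m _.
      have [hm|hm] := boolP (h m).
        rewrite b0 ?hm ?andbF // mulr0 mul0r big1 // => i _.
        by rewrite mulr0 mul0r mulr0.
      under eq_bigr => i _ do rewrite -mulrA mulrA.
      by rewrite -mulr_suml -mulrA ler_wpM2r ?mulr_ge0 // yv.
    by rewrite ler_pM2r // epos.
pose y k := iter k F 0.
have ygood k : good (y k).
  elim: k => [|k /goodF //]; split.
  - by move=> i j _; rewrite mxE.
  - by move=> i j; rewrite mxE.
  - move=> i j; rewrite [y _ _ _]mxE [F _ _ _]mxE QE divr_ge0 ?addr_ge0 //.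
    by apply: sumr_ge0 => l _; apply: sumr_ge0 => m _; rewrite !mxE mulr0.
  - by move=> i; rewrite big1 // => j _; rewrite mxE.
  - by move=> j hj; rewrite big1 // => i _; rewrite mxE mulr0.
pose l : 'M[R]_n.+1 := \matrix_(i, j) sup (range (fun k => y k i j)).
have ycvg i j : (y k i j @[k --> \oo] --> l i j)%classic.
  rewrite mxE; apply: sequences.nondecreasing_cvgn.
    by apply/sequences.nondecreasing_seqP => k; have [_ _ yF _ _] := ygood k; exact: yF.
  exists 1 => _ [k _ <-]; have [_ ynn _ y1 _] := ygood k.
  by apply: le_trans (y1 i); rewrite (bigD1 j) //= lerDl sumr_ge0.
have cvgS (f : 'I_n.+1 -> nat -> R) (g : 'I_n.+1 -> R) :
    (forall i, f i k @[k --> \oo] --> g i)%classic ->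
    (\sum_i f i k @[k --> \oo] --> \sum_i g i)%classic.
  by move=> fg; apply: (cvg_big (op := +%R)) => [|//]; exact: add_continuous.
exists v, l; split; first split=> //.
- move=> i j hij; have := ycvg i j.
  rewrite (_ : (fun k => y k i j) = (fun=> 0)); last first.
    by apply/funext => k; have [-> //] := ygood k.
  by move=> H; exact: (cvg_unique _ H (cvg_cst _)).
- move=> i j; apply: (cvgr_to_ge (ycvg i j)); apply: nearW => k.
  by have [_ ynn _ _ _] := ygood k.
- move=> i; apply: (cvgr_to_le (cvgS _ _ (fun j => ycvg i j))).
  by apply: nearW => k; have [_ _ _ y1 _] := ygood k.
- split=> // j hj.
  have H : (\sum_i v i * y k i j @[k --> \oo] --> \sum_i v i * l i j)%classic.
    by apply: cvgS => i; apply: cvgMl_tmp; exact: ycvg.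
  apply: (cvgr_to_le H).
  by apply: nearW => k; have [_ _ _ _ yv] := ygood k; exact: yv.
- move=> i j; rewrite -/(Q l) QE.
  (* The equation linking consecutive iterates passes to the limit. *)
  have H1 : ((y k.+1 i j * (d i + e j)) @[k --> \oo] --> l i j * (d i + e j))%classic.
    by apply: cvgMr_tmp; rewrite (sequences.cvg_shiftS (fun k => y k i j)).
  apply/esym/(cvg_unique _ H1) => //=.
  rewrite (_ : (fun k => _) = fun k => a i j +
      \sum_l0 \sum_m y k i m * b l0 m * y k l0 j); last first.
    by apply/funext => k; rewrite -QE; apply: FE; have [] := ygood k.
  apply: cvgD; first exact: cvg_cst.
  apply: (cvgS) => p'; apply: (cvgS) => q'; apply: cvgM; last exact: ycvg.
  by apply: cvgMr_tmp; exact: ycvg.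
Qed.

End Riccati.

(** * Split graphs *)

Section Projection.
Variable R : rcfType.

Definition orthoproj n (Q : 'M[R]_n) := Q^T = Q /\ Q *m Q = Q.

Lemma orthoproj_compl n (Q : 'M[R]_n) : orthoproj Q -> orthoproj (1%:M - Q).
Proof.
move=> [QT QQ]; split; first by rewrite linearB /= trmx1 QT.
by rewrite mulmxBl mul1mx mulmxBr mulmx1 QQ subrr subr0.
Qed.

Lemma orthoproj_ge0 n (Q : 'M[R]_n) (u : 'rV[R]_n) :
  orthoproj Q -> 0 <= (u *m Q *m u^T) 0 0.
Proof.
move=> [QT QQ].
have -> : u *m Q *m u^T = (u *m Q) *m (u *m Q)^T.
  by rewrite trmx_mul QT [RHS]mulmxA -[in RHS](mulmxA u) QQ.
exact: row_sqr_ge0.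
Qed.

Lemma orthoproj_le n (Q : 'M[R]_n) (u : 'rV[R]_n) :
  orthoproj Q -> (u *m Q *m u^T) 0 0 <= (u *m u^T) 0 0.
Proof.
move=> /orthoproj_compl /(orthoproj_ge0 u).
by rewrite mulmxBr mulmx1 mulmxBl !mxE subr_ge0.
Qed.

(** In the eigenbasis [P] the trace is the sum of (d_i - t) q_i, where the diagonal entries q_i of P
    Q P^T lie in [0, 1]. Dropping the negative terms and bounding the other q_i by 1 gives the
    claim. *)
Lemma orthoproj_trace_le n (L Q P : 'M[R]_n) (d : 'rV[R]_n) t :
  P *m P^T = 1%:M -> P *m L = diag_mx d *m P -> orthoproj Q ->
  \tr ((L - t%:M) *m Q) <= \sum_(i | t < d 0 i) (d 0 i - t).
Proof.
move=> PP PL Qproj; have PtP := mulmx1C PP.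
have LE : L - t%:M = P^T *m diag_mx (\row_i (d 0 i - t)) *m P.
  have -> : diag_mx (\row_i (d 0 i - t)) = diag_mx d - t%:M.
    by apply/matrixP => i j; rewrite !mxE mulrnBl.
  rewrite mulmxBr mulmxBl -mulmxA -PL mulmxA PtP mul1mx.
  by rewrite mul_mx_scalar -scalemxAl PtP scalemx1.
rewrite LE -!mulmxA mxtrace_mulC -!mulmxA.
rewrite /mxtrace [leRHS]big_mkcond; apply: ler_sum => i _.
have rc (A B : 'M[R]_n) : (row i A *m col i B) 0 0 = (A *m B) i i.
  by rewrite !mxE; apply: eq_bigr => k _; rewrite !mxE.
have q0 := orthoproj_ge0 (row i P) Qproj.
have q1 := orthoproj_le (row i P) Qproj.
rewrite tr_row -row_mul rc -mulmxA in q0.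
rewrite tr_row -row_mul !rc PP -mulmxA [1%:M i i]mxE eqxx in q1.
rewrite [diag_mx _ *m _]mul_diag_mx [in leLHS]mxE [X in X * _]mxE.
move: ((P *m (Q *m P^T)) i i) q0 q1 => q q0 q1.
case: ltP => dt; last by rewrite mulr_le0_ge0 ?subr_le0.
by rewrite ler_piMr // subr_ge0 ltW.
Qed.
End Projection.

Section Split.
Variables (R : realType) (n : nat) (h : 'I_n.+1 -> bool) (a : 'M[R]_n.+1).
Hypothesis a0 : forall i j, ~~ (h i && ~~ h j) -> a i j = 0.
Hypothesis apos : forall i j, h i -> ~~ h j -> 0 < a i j < 1.

Definition split_weights : 'M[R]_n.+1 :=
  \matrix_(i, j) ((h i && h j && (i != j))%:R + a i j + a j i).

Let b : 'M[R]_n.+1 := \matrix_(i, j) ((h i && ~~ h j)%:R - a i j).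
Let D : 'M[R]_n.+1 := diag_mx (\row_i \sum_j a i j).
Let E : 'M[R]_n.+1 := diag_mx (\row_j \sum_i b i j).
Let T := D - E + b^T - a.
Let N : R := \sum_i (h i)%:R.
Let L := laplacian split_weights.

(** The rank-one term kills row vectors with zero sum. It accounts for the clique and turns -a^T
    into b^T; a vertex outside H has degree N minus its entry of [E]. *)
Lemma split_laplacianE : L = T + N%:M - (const_mx 1 : 'cV_n.+1) *m \row_i (h i)%:R.
Proof.
apply/matrixP => i j; rewrite /L /laplacian /T !mxE big_ord1 !mxE mul1r.
have [<-{j}|ij] := eqVneq i j; last first.
  rewrite !mulr0n; case: (h i); case: (h j) => /=; lra.
rewrite !mulr1n !andbF a0 ?andbN //.
have -> : \sum_j split_weights i j
    = \sum_j (h i && h j && (i != j))%:R + \sum_j a i j + \sum_j a j i.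
  by rewrite -!big_split; apply: eq_bigr => j _; rewrite mxE.
have -> : \sum_j b j i = \sum_j (h j && ~~ h i)%:R - \sum_j a j i.
  by rewrite -sumrB; apply: eq_bigr => j _; rewrite mxE.
have -> : \sum_j (h i && h j && (i != j))%:R
    = N - \sum_j (h j && ~~ h i)%:R - (h i)%:R :> R.
  case: (boolP (h i)) => hi.
    rewrite /N [in RHS](bigD1 i) //= [X in _ - X - _]big1 => [|j _]; last first.
      by rewrite andbF.
    rewrite (bigD1 i) //= eqxx andbF add0r hi subr0 addrAC subrr add0r.
    by apply: eq_bigr => j ji; rewrite eq_sym ji andbT.
  rewrite big1 // subr0 -sumrB big1 // => j _.
  by rewrite andbT subrr.
by rewrite /=; lra.
Qed.

(** Coordinate projection onto H. The block position of a matrix is expressed by which products with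
    [PI] fix it and which vanish. *)
Let PI : 'M[R]_n.+1 := diag_mx (\row_i (h i)%:R).

Section Graph.
Variables (v : 'I_n.+1 -> R) (y : 'M[R]_n.+1).
Hypothesis vy : riccati_pair h a b v y.

Let PIl (c : 'M[R]_n.+1) : (forall i j, ~~ h i -> c i j = 0) -> PI *m c = c.
Proof.
move=> c0; apply/matrixP => i j; rewrite mul_diag_mx !mxE.
by have [_|/c0 ->] := boolP (h i); rewrite ?mul1r ?mulr0.
Qed.

Let PIr (c : 'M[R]_n.+1) : (forall i j, h j -> c i j = 0) -> c *m PI = 0.
Proof.
move=> c0; apply/matrixP => i j; rewrite mul_mx_diag !mxE.
by have [/c0 ->|_] := boolP (h j); rewrite ?mul0r ?mulr0.
Qed.

Let y0 : forall i j, ~~ (h i && ~~ h j) -> y i j = 0.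
Proof. by have [[]] := vy. Qed.
Let ypos i j : 0 <= y i j.
Proof. by have [[]] := vy. Qed.

Let b0 : forall i j, ~~ (h i && ~~ h j) -> b i j = 0.
Proof. by move=> i j hij; rewrite mxE a0 // (negPf hij) subrr. Qed.
Let bpos i j : h i -> ~~ h j -> 0 < b i j.
Proof. by move=> hi hj; rewrite mxE hi hj subr_gt0; case/andP: (apos hi hj). Qed.
Let bge0 i j : 0 <= b i j.
Proof.
by have [/andP[hi hj]|/b0 -> //] := boolP (h i && ~~ h j); apply/ltW/bpos.
Qed.

Let aPI : a *m PI = 0. Proof. by apply: PIr => i j hj; rewrite a0 ?hj ?andbF. Qed.
Let PIb : PI *m b = b. Proof. by apply: PIl => i j hi; rewrite b0 ?(negPf hi). Qed.
Let bPI : b *m PI = 0. Proof. by apply: PIr => i j hj; rewrite b0 ?hj ?andbF. Qed.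
Let PIy : PI *m y = y. Proof. by apply: PIl => i j hi; rewrite y0 ?(negPf hi). Qed.
Let PIT : PI^T = PI. Proof. exact: tr_diag_mx. Qed.
Let btPI : b^T *m PI = b^T. Proof. by rewrite -PIT -trmx_mul PIb. Qed.
Let PIbt : PI *m b^T = 0. Proof. by rewrite -PIT -trmx_mul bPI trmx0. Qed.
Let DPI : D *m PI = D.
Proof.
apply/matrixP => i j; rewrite mul_mx_diag !mxE.
have [<-|_] := eqVneq i j; last by rewrite !mulr0n mul0r.
have [hi|hi] := boolP (h i); rewrite ?mulr1 //.
by rewrite big1 ?mul0r // => k _; rewrite a0 ?(negPf hi).
Qed.
Let PIE : PI *m E = 0.
Proof.
apply/matrixP => i j; rewrite mul_diag_mx !mxE.
have [_|_] := eqVneq i j; last by rewrite !mulr0n mulr0.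
have [hi|hi] := boolP (h i); rewrite ?mul0r // mul1r mulr1n.
by rewrite big1 // => k _; rewrite b0 ?hi ?andbF.
Qed.
Let EPI : E *m PI = 0.
Proof. by rewrite -[E *m PI]trmxK trmx_mul PIT tr_diag_mx PIE trmx0. Qed.
Let Ricc : a + y *m b^T *m y = D *m y + y *m E.
Proof.
apply/matrixP => i j; have [_ H] := vy; rewrite [LHS]mxE H.
by rewrite mul_diag_mx mul_mx_diag !mxE mulrDr mulrC.
Qed.

Let ay : a *m y = 0.
Proof. by rewrite -PIy mulmxA aPI mul0mx. Qed.
Let Ey : E *m y = 0.
Proof. by rewrite -PIy mulmxA EPI mul0mx. Qed.

(* Hence [1 - PI + y] sends row eigenvectors of [T] to row eigenvectors of
   [b^T y - E], or to zero. *)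
Lemma split_intertwining : T *m (1%:M - PI + y) = (1%:M - PI + y) *m (b^T *m y - E).
Proof.
have -> : T *m (1%:M - PI + y) = D *m y + b^T *m y - E - a.
  rewrite /T !(mulmxDl, mulmxDr, mulmxBl, mulmxBr, mulNmx, mulmxN) !mulmx1.
  rewrite DPI EPI btPI aPI ay Ey.
  by apply/matrixP => i j; rewrite !mxE; ring.
rewrite !(mulmxDl, mulmxDr, mulmxBl, mulmxBr, mulNmx, mulmxN) !mul1mx !mulmxA.
rewrite PIbt PIE mul0mx.
(* The Riccati equation enters here, trading the quadratic term for linear ones. *)
have -> : y *m b^T *m y = D *m y + y *m E - a by rewrite -Ricc addrAC subrr add0r.
by apply/matrixP => i j; rewrite !mxE; ring.
Qed.

(** The image [c] of [x] satisfies (e_j + mu) c_j = sum_i c_i W_ij, where W = b^T y is nonnegative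
    with row sums at most e_i. Summing absolute values leaves mu * sum_j |c_j| <= 0. *)
Lemma split_eigenvector (x : 'rV[R]_n.+1) mu :
  0 < mu -> x *m T = mu *: x -> x *m (1%:M - PI + y) = 0.
Proof.
move=> mu0 xT; have := split_intertwining.
have [W defW] : {W | W = b^T *m y} by exists (b^T *m y).
rewrite -defW => /(congr1 (mulmx x)); rewrite !mulmxA xT -scalemxAl.
move: (x *m _) => c cE.
pose e j := \sum_i b i j.
have ege0 j : 0 <= e j by apply: sumr_ge0.
have Wge0 i j : 0 <= W i j.
  by rewrite defW mxE sumr_ge0 // => k _; rewrite [b^T _ _]mxE mulr_ge0.
have W1 i : \sum_j W i j <= e i.
  rewrite (eq_bigr (fun j => \sum_k b^T i k * y k j)) => [|j _]; last first.
    by rewrite defW mxE.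
  rewrite exchange_big /=; apply: ler_sum => k _; rewrite -mulr_sumr [b^T _ _]mxE.
  by rewrite ler_piMr //; have [[_ _ _ y1 _] _] := vy.
have cj j : (e j + mu) * c 0 j = \sum_i c 0 i * W i j.
  have := congr1 (fun w : 'rV_n.+1 => w 0 j) cE.
  rewrite /= mulmxBr mul_mx_diag !mxE -/(e j) => cEj.
  by rewrite mulrDl cEj; ring.
have le : \sum_j (e j + mu) * `|c 0 j| <= \sum_j e j * `|c 0 j|.
  apply: (@le_trans _ _ (\sum_j \sum_i `|c 0 i| * W i j)).
    apply: ler_sum => j _; rewrite -[X in X * _]ger0_norm ?addr_ge0 ?(ltW mu0) //.
    rewrite -normrM cj; apply: le_trans (ler_norm_sum _ _ _) _.
    by apply: ler_sum => i _; rewrite normrM (ger0_norm (Wge0 _ _)).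
  rewrite exchange_big; apply: ler_sum => i _.
  by rewrite -mulr_sumr mulrC ler_wpM2r.
have : \sum_j mu * `|c 0 j| == 0.
  rewrite eq_le; apply/andP; split.
    move: le; rewrite -subr_le0 -sumrB; congr (_ <= 0).
    by apply: eq_bigr => j _; ring.
  by apply: sumr_ge0 => j _; rewrite mulr_ge0 ?(ltW mu0).
rewrite psumr_eq0 => [/allP H|j _]; last by rewrite mulr_ge0 ?(ltW mu0).
apply/rowP => j; rewrite [RHS]mxE; have := H j (mem_index_enum j).
by rewrite mulf_eq0 (gt_eqF mu0) normr_eq0 => /eqP.
Qed.

(** By [split_eigenvector] the rows of [X] are determined by their H-parts, and these span an
    invariant subspace of the M-matrix D - y b^T with the same eigenvalues. [Mmatrix_trace] bounds
    their sum by the trace, and tr (y b^T) >= 0. *)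
Lemma split_trace p (X : 'M[R]_(p, n.+1)) (mu : 'rV[R]_p) :
  row_free X -> (forall i, 0 < mu 0 i) -> X *m T = diag_mx mu *m X ->
  \sum_i mu 0 i <= \sum_i \sum_j a i j.
Proof.
move=> Xfree mupos XT.
have X0 : X *m (1%:M - PI + y) = 0.
  apply/row_matrixP => i; rewrite row_mul row0.
  apply: split_eigenvector (mupos i) _.
  by rewrite -row_mul XT; apply/rowP => j; rewrite mul_diag_mx !mxE.
pose B := D - y *m b^T.
have Xy : X *m y = - (X *m (1%:M - PI)).
  by apply/eqP; rewrite -addr_eq0 addrC -mulmxDr X0.
(* [X] is recovered from its H-part as X PI (1 - y), so no rank is lost. *)
have XPfree : row_free (X *m PI).
  rewrite /row_free eqn_leq rank_leq_row -{1}(eqP Xfree).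
  have {1}-> : X = X *m PI *m (1%:M - y).
    rewrite mulmxBr mulmx1 -mulmxA PIy Xy opprK mulmxBr mulmx1.
    by rewrite addrC subrK.
  exact: mxrankM_maxl.
have XB : X *m PI *m B = diag_mx mu *m (X *m PI).
  have PID : PI *m D = D.
    by rewrite -[PI *m D]trmxK trmx_mul PIT [D^T]tr_diag_mx DPI tr_diag_mx.
  have PB : PI *m B = D - y *m b^T by rewrite mulmxBr mulmxA PIy PID.
  rewrite [RHS]mulmxA -XT -[LHS]mulmxA PB -[RHS]mulmxA.
  rewrite mulmxBr (mulmxA X y) Xy mulNmx opprK -(mulmxA X) mulmxBl mul1mx PIbt subr0.
  rewrite -mulmxDr; congr (_ *m _).
  by rewrite /T mulmxBl mulmxDl mulmxBl DPI EPI btPI aPI !subr0.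
have -> : \sum_i mu 0 i = \tr (diag_mx mu) by rewrite mxtrace_diag.
have vpos : forall i, 0 < v i by have [[]] := vy.
have [vH vL] : (forall i, h i -> v i * (\sum_j a i j) = \sum_j v j * b i j) /\
      (forall j, ~~ h j -> \sum_i v i * y i j <= v j) by have [[]] := vy.
have ybge0 i j : 0 <= (y *m b^T) i j.
  by rewrite mxE sumr_ge0 // => k _; rewrite mxE mulr_ge0.
apply: (@le_trans _ _ (\tr B)).
  apply: (@Mmatrix_trace _ _ B (\row_i v i) _ (X *m PI)) => //.
  - move=> i j ij; rewrite [B i j]mxE [X in _ + X]mxE mxE (negPf ij) mulr0n.
    by rewrite add0r oppr_le0.
  - by move=> i; rewrite mxE.
  (* On H, v y b^T <= v b^T = v D by the two conditions on [v]; off H the term v y b^T vanishes. *)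
  move=> j; rewrite mulmxBr mul_mx_diag mulmxA [leRHS]mxE [X in X + _]mxE.
  rewrite [X in _ + X]mxE [X in X * _]mxE [X in _ * X]mxE subr_ge0.
  have [hj|hj] := boolP (h j).
    rewrite vH // mxE; apply: ler_sum => l _; rewrite [X in _ * X]mxE.
    have [hl|hl] := boolP (h l); first by rewrite b0 ?hl ?andbF // !mulr0.
    rewrite ler_wpM2r //; apply: le_trans (vL _ hl).
    by rewrite mxE; apply: ler_sum => k _; rewrite mxE.
  rewrite mxE big1 => [|l _]; last first.
    by rewrite [X in _ * X]mxE b0 ?(negPf hj) // mulr0.
  rewrite mulr_ge0 ?(ltW (vpos j)) // sumr_ge0 // => l _.
  by rewrite a0 ?(negPf hj).
have -> : \tr B = \sum_i \sum_j a i j - \tr (y *m b^T).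
  rewrite /B linearB /=; congr (_ - _).
  by rewrite mxtrace_diag; apply: eq_bigr => i _; rewrite mxE.
by rewrite lerBlDr lerDl sumr_ge0.
Qed.

End Graph.

Lemma split_weights_sym : split_weights^T = split_weights.
Proof.
by apply/matrixP => i j; rewrite !mxE eq_sym [h j && _]andbC addrAC.
Qed.

Lemma laplacian_sym m (A : 'M[R]_m) : A^T = A -> (laplacian A)^T = laplacian A.
Proof. by move=> AT; rewrite linearB /= tr_diag_mx AT. Qed.

(** Ky Fan bounds the trace by the sum of the positive eigenvalues of L - N. Their eigenvectors have
    zero sum, so they are eigenvectors of [T] and [split_trace] applies. *)
Lemma split_bound_open (Q : 'M[R]_n.+1) :
  orthoproj Q -> \tr ((L - N%:M) *m Q) <= \sum_i \sum_j a i j.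
Proof.
move=> Qproj.
have [P [d [PP PL]]] := symmetric_spectral (laplacian_sym split_weights_sym).
apply: le_trans (orthoproj_trace_le N PP PL Qproj) _.
have [|||| v [y vy]] := @riccati_solution R n h a b.
- exact: a0.
- by move=> i j hij; rewrite mxE a0 // (negPf hij) subrr.
- by move=> i j hi hj; case/andP: (apos hi hj).
- by move=> i j hi hj; rewrite mxE hi hj subr_gt0; case/andP: (apos hi hj).
pose S := [pred r | N < d 0 r].
pose X : 'M_(#|S|, n.+1) := rowsub (@enum_val _ S) P.
pose mu : 'rV[R]_(#|S|) := \row_k (d 0 (enum_val k) - N).
have -> : \sum_(i | N < d 0 i) (d 0 i - N) = \sum_k mu 0 k.
  rewrite (eq_bigl (mem S)) // big_enum_val; by apply: eq_bigr => k _; rewrite mxE.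
have N0 : 0 <= N by apply: sumr_ge0.
have dS (k : 'I_#|S|) : N < d 0 (enum_val k) by have := enum_valP k.
(* The Laplacian kills the all-ones vector, so an eigenvector with nonzero eigenvalue is orthogonal
   to it. *)
have P1 r : N < d 0 r -> (P *m const_mx 1 : 'cV_n.+1) r 0 = 0.
  move=> dr; have := congr1 (fun M => M *m const_mx 1 : 'cV_n.+1) PL.
  rewrite -mulmxA laplacian_ones mulmx0 -mulmxA mul_diag_mx => /matrixP /(_ r 0).
  rewrite [LHS]mxE [RHS]mxE => /esym/eqP; rewrite mulf_eq0 gt_eqF ?(le_lt_trans N0) //.
  by move=> /eqP.
apply: (split_trace vy (X := X)).
- apply/row_freeP; exists X^T; apply/matrixP => k l.
  have := congr1 (fun M : 'M_n.+1 => M (enum_val k) (enum_val l)) PP.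
  rewrite [RHS]mxE (inj_eq enum_val_inj) [RHS in _ -> _ = RHS]mxE => <-.
  by rewrite !mxE; apply: eq_bigr => m _; rewrite !mxE.
- by move=> k; rewrite mxE subr_gt0.
apply/row_matrixP => k.
have rX : row k X = row (enum_val k) P by rewrite row_rowsub.
rewrite row_mul rX.
have -> : T = L - N%:M + (const_mx 1 : 'cV_n.+1) *m \row_i (h i)%:R.
  by rewrite split_laplacianE; apply/matrixP => i j; rewrite !mxE; ring.
have PLr : row (enum_val k) P *m L = d 0 (enum_val k) *: row (enum_val k) P.
  by rewrite -row_mul PL; apply/rowP => j; rewrite mul_diag_mx !mxE.
have P1r : row (enum_val k) P *m (const_mx 1 : 'cV_n.+1) = 0.
  by rewrite -row_mul; apply/rowP => j; rewrite ord1 mxE P1 // mxE.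
rewrite mulmxDr mulmxBr PLr mulmxA P1r mul0mx addr0 mul_mx_scalar.
by apply/rowP => j; rewrite mul_diag_mx !mxE; ring.
Qed.
End Split.

(** * The quadratic form of a projection on edges *)

Section Gap.
Variables (R : realType) (n : nat).
Implicit Types A Q : 'M[R]_n.

(** For symmetric [Q] this is the quadratic form at e_i - e_j. It makes the linearity of the trace
    in the weights explicit. *)
Definition edge_form Q i j : R := Q i i + Q j j - 2 * Q i j.

Let edge i j : 'rV[R]_n := delta_mx 0 i - delta_mx 0 j.

Lemma edge_formE Q i j : Q^T = Q ->
  edge_form Q i j = (edge i j *m Q *m (edge i j)^T) 0 0.
Proof.
move=> QT; rewrite /edge linearB /= !trmx_delta mulmxBr !mulmxBl -!rowE -!colE !mxE.
by rewrite /edge_form -[in Q j i]QT mxE; ring.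
Qed.

Lemma edge_form_ge0 Q i j : orthoproj Q -> 0 <= edge_form Q i j.
Proof. by move=> Qp; rewrite edge_formE ?orthoproj_ge0 //; case: Qp. Qed.

Lemma edge_form_le2 Q i j : orthoproj Q -> edge_form Q i j <= 2.
Proof.
move=> Qp; have [<-|ij] := eqVneq i j.
  by rewrite /edge_form; lra.
rewrite edge_formE; last by case: Qp.
apply: le_trans (orthoproj_le _ Qp) _.
rewrite /edge linearB /= !trmx_delta mulmxBr !mulmxBl !mul_delta_mx_cond.
rewrite !eqxx (negPf ij) eq_sym (negPf ij) !mulr0n !mulr1n !mxE !eqxx /=; lra.
Qed.

Lemma laplacian_edge_form A Q : A^T = A -> Q^T = Q ->
  2 * \tr (laplacian A *m Q) = \sum_i \sum_j A i j * edge_form Q i j.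
Proof.
move=> AT QT.
have -> : \tr (laplacian A *m Q)
    = \sum_i \sum_j A i j * Q i i - \sum_i \sum_j A i j * Q i j.
  rewrite mulmxBl linearB /=; congr (_ - _).
    by apply: eq_bigr => i _; rewrite mul_diag_mx !mxE mulr_suml.
  apply: eq_bigr => i _; rewrite mxE; apply: eq_bigr => j _.
  by rewrite -[in Q j i]QT mxE.
set X := \sum_i \sum_j _; set Y := \sum_i \sum_j _.
have XE : \sum_i \sum_j A i j * Q j j = X.
  rewrite exchange_big; apply: eq_bigr => i _; apply: eq_bigr => j _.
  by rewrite -[in A j i]AT mxE.
have -> : \sum_i \sum_j A i j * edge_form Q i j = X + X - 2 * Y.
  rewrite -{2}XE mulr_sumr -big_split -sumrB; apply: eq_bigr => i _ /=.
  rewrite mulr_sumr -big_split -sumrB; apply: eq_bigr => j _ /=.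
  by rewrite /edge_form; ring.
by ring.
Qed.

(** The case of constant weights, for shifting all weights at once: the cross terms vanish because
    the rows of [Q] sum to zero. *)
Lemma sum_edge_form Q : Q *m const_mx 1 = 0 :> 'cV_n ->
  \sum_i \sum_j edge_form Q i j = 2 * n%:R * \tr Q.
Proof.
move=> Q1; rewrite /edge_form.
have r0 i : \sum_j Q i j = 0.
  have := congr1 (fun M : 'cV_n => M i 0) Q1; rewrite !mxE => H; rewrite -[RHS]H.
  by apply: eq_bigr => j _; rewrite mxE mulr1.
have -> : \sum_i \sum_j (Q i i + Q j j - 2 * Q i j)
   = \sum_i (n%:R * Q i i + \tr Q).
  apply: eq_bigr => i _; rewrite sumrB big_split /= sumr_const card_ord.
  by rewrite -mulr_sumr r0 mulr0 subr0 mulr_natl.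
rewrite big_split /= -mulr_sumr sumr_const card_ord -mulr_natl /mxtrace.
by ring.
Qed.

End Gap.

Lemma affine_le0 (R : realFieldType) (x y : R) :
  (forall t, 0 < t < 1 -> (1 - t) * x + t * y <= 0) -> x <= 0.
Proof.
move=> H; rewrite leNgt; apply/negP => x0.
have y0 : y < 0 by have := H (1 / 2); lra.
have xy : 0 < 2 * (x - y) by lra.
(* Halfway from 0 to the zero x / (x - y) of the affine function, its value is x / 2 > 0. *)
have := H (x / (2 * (x - y))); rewrite divr_gt0 // ltr_pdivrMr //.
have -> : (1 - x / (2 * (x - y))) * x + x / (2 * (x - y)) * y = x / 2.
  by field; lra.
by lra.
Qed.

Section SplitClosed.
Variables (R : realType) (n : nat) (h : 'I_n.+1 -> bool) (Q : 'M[R]_n.+1).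
Hypothesis Qproj : orthoproj Q.
Let N : R := \sum_i (h i)%:R.
Let q := edge_form Q.

(** This is [split_bound_open] in terms of edge forms, with weights now allowed to reach 0 and 1.
    Both sides are affine in [g], so [g] can be approached from the open case. *)
Lemma split_bound (g : 'I_n.+1 -> 'I_n.+1 -> R) : (forall i j, 0 <= g i j <= 1) ->
  \sum_i \sum_j (h i && h j && (i != j))%:R * q i j
    + 2 * \sum_i \sum_j (h i && ~~ h j)%:R * g i j * q i j
  <= 2 * (N * \tr Q + \sum_i \sum_j (h i && ~~ h j)%:R * g i j).
Proof.
move=> g01.
set K := \sum_i \sum_j _.
have QT : Q^T = Q by case: Qproj.
have qsym i j : q i j = q j i.
  by rewrite /q /edge_form -[in Q i j]QT mxE; ring.
pose f g := \sum_i \sum_j (h i && ~~ h j)%:R * g i j * (q i j - 1).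
have fE g' : f g' = \sum_i \sum_j (h i && ~~ h j)%:R * g' i j * q i j
     - \sum_i \sum_j (h i && ~~ h j)%:R * g' i j.
  rewrite -sumrB; apply: eq_bigr => i _; rewrite -sumrB; apply: eq_bigr => j _.
  by rewrite mulrBr mulr1.
have open_case (g' : 'I_n.+1 -> 'I_n.+1 -> R) :
    (forall i j, 0 < g' i j < 1) -> K / 2 - N * \tr Q + f g' <= 0.
  move=> g'01; pose a : 'M[R]_n.+1 := \matrix_(i, j) ((h i && ~~ h j)%:R * g' i j).
  have a0 i j : ~~ (h i && ~~ h j) -> a i j = 0.
    by move=> /negPf hij; rewrite mxE hij mul0r.
  have apos i j : h i -> ~~ h j -> 0 < a i j < 1.
    by move=> hi hj; rewrite mxE hi hj mul1r.
  have := split_bound_open a0 apos Qproj.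
  rewrite mulmxBl linearB /= mul_scalar_mx mxtraceZ.
  have := laplacian_edge_form (split_weights_sym h a) QT.
  have -> : \sum_i \sum_j split_weights h a i j * edge_form Q i j
      = K + 2 * \sum_i \sum_j (h i && ~~ h j)%:R * g' i j * q i j.
    have -> : 2 * \sum_i \sum_j (h i && ~~ h j)%:R * g' i j * q i j
        = \sum_i \sum_j a i j * q i j + \sum_i \sum_j a j i * q i j.
      rewrite [X in _ = _ + X]exchange_big mulr2n mulrDl mul1r /=.
      congr (_ + _); apply: eq_bigr => i _; apply: eq_bigr => j _; rewrite mxE //.
      by rewrite qsym.
    rewrite -!big_split; apply: eq_bigr => i _ /=.
    rewrite -!big_split; apply: eq_bigr => j _ /=.
    by rewrite [split_weights _ _ _ _]mxE -/(q i j); ring.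
  have -> : \sum_i \sum_j a i j = \sum_i \sum_j (h i && ~~ h j)%:R * g' i j.
    by apply: eq_bigr => i _; apply: eq_bigr => j _; rewrite mxE.
  by rewrite fE -/N; lra.
have : K / 2 - N * \tr Q + f g <= 0.
  (* Moving [g] towards the constant 1/2 makes the weights lie strictly between 0 and 1. *)
  apply: (@affine_le0 _ _ (K / 2 - N * \tr Q + f (fun _ _ => 1 / 2))) => t t01.
  have := open_case (fun i j => (1 - t) * g i j + t * (1 / 2)).
  have -> : f (fun i j => (1 - t) * g i j + t * (1 / 2))
      = (1 - t) * f g + t * f (fun _ _ => 1 / 2).
    rewrite /f !mulr_sumr -big_split; apply: eq_bigr => i _ /=.
    by rewrite !mulr_sumr -big_split; apply: eq_bigr => j _ /=; ring.
  move=> H; have {}H : K / 2 - N * \tr Q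
     + ((1 - t) * f g + t * f (fun _ _ => 1 / 2)) <= 0.
    by apply: H => i j; have := g01 i j; nra.
  by nra.
by rewrite fE; lra.
Qed.

End SplitClosed.

(** * Graphs and weighted graphs *)

Section Graph.
Variables (R : realType) (n : nat) (Q : 'M[R]_n.+1).
Hypothesis Qproj : orthoproj Q.
Let q := edge_form Q.

(** Let H be the vertices of degree at least tr Q. Completing H to a clique keeps the minima and
    does not decrease the left side, as q >= 0. Deleting the weights outside H lowers the right side
    by 2 LL and the left side by no more, as q <= 2. What remains is [split_bound]. *)
Lemma graph_bound (g : 'I_n.+1 -> 'I_n.+1 -> R) :
  (forall i j, g i j = g j i) -> (forall i j, 0 <= g i j <= 1) ->
  \sum_i \sum_j g i j * q i j <= 2 * \sum_i Num.min (\tr Q) (\sum_j g i j).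
Proof.
move=> gsym g01.
pose h i := \tr Q <= \sum_j g i j.
have q0 i j : 0 <= q i j by apply: edge_form_ge0.
have q2 i j : q i j <= 2 by apply: edge_form_le2.
have qsym i j : q i j = q j i.
  have [QT _] := Qproj; by rewrite /q /edge_form -[in Q i j]QT mxE; ring.
have qii i : q i i = 0 by rewrite /q /edge_form; ring.
pose N : R := \sum_i (h i)%:R.
pose HL := \sum_i \sum_j (h i && ~~ h j)%:R * g i j.
pose HLq := \sum_i \sum_j (h i && ~~ h j)%:R * g i j * q i j.
pose LL := \sum_i \sum_j (~~ h i && ~~ h j)%:R * g i j.
pose HH := \sum_i \sum_j (h i && h j && (i != j))%:R * q i j.
have minE : \sum_i Num.min (\tr Q) (\sum_j g i j) = N * \tr Q + HL + LL.
  have -> : HL = \sum_i \sum_j (~~ h i && h j)%:R * g i j.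
    rewrite /HL exchange_big; apply: eq_bigr => i _; apply: eq_bigr => j _.
    by rewrite gsym andbC.
  rewrite /N mulr_suml -!big_split; apply: eq_bigr => i _ /=.
  have [hi|hi] := boolP (h i).
    rewrite min_l // mul1r.
    have z (F : 'I_n.+1 -> bool) : \sum_j (~~ true && F j)%:R * g i j = 0.
      by rewrite big1 // => j _; rewrite mul0r.
    by rewrite !z !addr0.
  rewrite min_r; last by move: hi; rewrite /h -ltNge => /ltW.
  rewrite mul0r add0r -big_split; apply: eq_bigr => j _ /=.
  by case: (h j); rewrite /= ?mul1r ?mul0r ?addr0 ?add0r.
have le : \sum_i \sum_j g i j * q i j <= HH + (HLq + HLq) + 2 * LL.
  rewrite {2}(_ : HLq = \sum_i \sum_j (h j && ~~ h i)%:R * g j i * q j i); last first.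
    by rewrite /HLq exchange_big.
  rewrite /HH /HLq /LL mulr_sumr -!big_split.
  apply: ler_sum => i _ /=; rewrite mulr_sumr -!big_split.
  apply: ler_sum => j _ /=; have := g01 i j; have := q0 i j; have := q2 i j.
  rewrite (gsym j i) (qsym j i) => q2' q0' /andP[g0 g1].
  case: (h i); case: (h j); rewrite /= ?mul1r ?mul0r ?mulr0 ?addr0 ?add0r //.
    by have [<-|_] := eqVneq i j; rewrite ?qii ?mulr0 // mul1r ler_piMl.
  by rewrite mulrC ler_wpM2r.
rewrite minE; apply: le_trans le _.
have := split_bound h Qproj g01; rewrite -/q -/N -/HH -/HL -/HLq; lra.
Qed.

End Graph.

(** * Sums of the largest entries of the rows *)

Section Rows.
Variable R : realType.

(** Makes the right-hand side additive over monotone functions of one matrix. *)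
Lemma decreasing_seq_map (f : R -> R) (s : seq R) : {homo f : x y / x <= y} ->
  decreasing_seq [seq f x | x <- s] = [seq f x | x <- decreasing_seq s].
Proof.
move=> fhomo; apply: (@sorted_eq _ >=%R).
- by move=> x y z; exact: ge_trans.
- by move=> x y; rewrite andbC => /le_anti.
- exact/sort_sorted/ge_total.
- apply: (homo_sorted (e := >=%R)); first by move=> x y; apply: fhomo.
  exact/sort_sorted/ge_total.
rewrite (perm_trans (y := [seq f x | x <- s])) ?perm_sort //.
by rewrite perm_map // perm_sym perm_sort.
Qed.

Lemma decreasing_row_map n (A B : 'M[R]_n) (f : R -> R) i :
  {homo f : x y / x <= y} -> (forall j, j != i -> B i j = f (A i j)) ->
  decreasing_row B i = [seq f x | x <- decreasing_row A i].
Proof.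
move=> fhomo BA; rewrite /decreasing_row -decreasing_seq_map //.
congr decreasing_seq; rewrite -map_comp; apply/eq_in_map => j.
by rewrite mem_enum !inE => /BA.
Qed.

Lemma size_decreasing_row n (A : 'M[R]_n) i : size (decreasing_row A i) = n.-1.
Proof. by rewrite size_sort size_map -cardE cardC1 card_ord. Qed.

Lemma mem_decreasing_row n (A : 'M[R]_n) i x :
  x \in decreasing_row A i -> exists2 j, j != i & x = A i j.
Proof.
rewrite mem_sort => /mapP [j]; rewrite mem_enum !inE => ji ->.
by exists j.
Qed.

(* Only [k <= size s] is meaningful: the sequence is padded with zeros *)
Definition prefix_sum k (s : seq R) := \sum_(j < k) s`_j.

(** The ones come first, so the prefix collects them until [k] or their total is reached. *)
Lemma prefix_sum01 k (s : seq R) : sorted >=%R s -> {in s, forall x, x = 0 \/ x = 1} ->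
  (k <= size s)%N -> Num.min k%:R (\sum_(x <- s) x) <= prefix_sum k s.
Proof.
elim: s k => [|x s IHs] [|k] //= srt s01 ks; rewrite /prefix_sum ?big_ord0.
- by rewrite ge_min lexx.
- by rewrite ge_min lexx.
have xs : {in s, forall y, y = 0 \/ y = 1}.
  by move=> y ys; apply: s01; rewrite inE ys orbT.
rewrite big_ord_recl big_cons /=.
have [x0|x1] := s01 x (mem_head _ _).
  have -> : \sum_(y <- s) y = 0.
    rewrite big_seq big1 // => y ys; have [//|y1] := xs _ ys.
    have := order_path_min (@ge_trans _ R) srt => /allP /(_ _ ys).
    by rewrite x0 y1 /= ler10.
  rewrite x0 !add0r ge_min; apply/orP; right; rewrite sumr_ge0 // => j _.
  have [js|js] := ltnP j (size s); last by rewrite nth_default.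
  by have [->|->] := xs _ (mem_nth 0 js).
have := IHs k (path_sorted srt) xs ks; rewrite /prefix_sum x1.
rewrite -(lerD2l 1) addr_minr; apply: le_trans.
by rewrite -natr1 [_ + 1]addrC.
Qed.

End Rows.

Section Weighted.
Variables (R : realType) (n k : nat) (Q : 'M[R]_n.+1).
Hypotheses (Qproj : orthoproj Q) (Q1 : Q *m const_mx 1 = 0 :> 'cV_n.+1).
Hypotheses (trQ : \tr Q = k%:R) (kn : (k <= n)%N).
Let q := edge_form Q.

Let qii i : q i i = 0.
Proof. by rewrite /q /edge_form; ring. Qed.

(** This is d_1^* + ... + d_k^* with the two sums exchanged. *)
Definition row_prefix (A : 'M[R]_n.+1) := \sum_i prefix_sum k (decreasing_row A i).

Lemma zero_one_bound (A : 'M[R]_n.+1) : A^T = A -> (forall i j, A i j = 0 \/ A i j = 1) ->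
  (forall i, A i i = 0) ->
  \sum_i \sum_j A i j * q i j <= 2 * row_prefix A.
Proof.
move=> AT A01 A0.
apply: le_trans (graph_bound Qproj (g := fun i j => A i j) _ _) _.
- by move=> i j; rewrite -[in LHS]AT mxE.
- by move=> i j; have [->|->] := A01 i j; rewrite ?lexx ?ler01.
rewrite ler_wpM2l // trQ; apply: ler_sum => i _.
have -> : \sum_j A i j = \sum_(x <- decreasing_row A i) x.
  rewrite (perm_big _ (permEl (perm_sort _ _))) /= big_map big_enum /=.
  by rewrite (bigD1 i) //= A0 add0r; apply: eq_bigl => j; rewrite !inE.
apply: prefix_sum01; first exact/sort_sorted/ge_total.
  by move=> x /mem_decreasing_row [j _ ->].
by rewrite size_decreasing_row.
Qed.

(** Induction on the number of positive entries. With [c] the smallest of them, A = f(A) + c t(A),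
    where [f] subtracts [c] and truncates at 0, and [t] is the indicator of x >= c. Both are
    monotone, so sorted rows split the same way; f(A) has fewer positive entries and t(A) is a
    graph. *)
Lemma nonneg_bound (A : 'M[R]_n.+1) : A^T = A -> (forall i j, 0 <= A i j) ->
  (forall i, A i i = 0) ->
  \sum_i \sum_j A i j * q i j <= 2 * row_prefix A.
Proof.
move: {2}(#|[set p | 0 < A p.1 p.2]|) (leqnn #|[set p | 0 < A p.1 p.2]|) => m.
elim: m A => [|m IHm] A cA AT Age0 A0.
  have Az i j : A i j = 0.
    apply/eqP; rewrite eq_le Age0 andbT leNgt; apply/negP => Aij.
    move: cA; rewrite leqn0 cards_eq0 => /eqP /setP /(_ (i, j)).
    by rewrite !inE Aij.
  by apply: zero_one_bound => // i j; left.
have [/existsP [p pA]|noA] := boolP [exists p, 0 < A p.1 p.2]; last first.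
  apply: IHm => //; rewrite (_ : [set p | _] = finset.set0) ?cards0 //.
  apply/setP => p; rewrite !inE; apply: contraNF noA => pA.
  by apply/existsP; exists p.
have [p0 p0A p0min] := @arg_minP _ _ _ p (fun p => 0 < A p.1 p.2) (fun p => A p.1 p.2) pA.
pose c : R := A p0.1 p0.2; have c0 : 0 < c := p0A.
pose f x : R := Num.max (x - c) 0; pose t x : R := (c <= x)%R%:R.
pose A' : 'M[R]_n.+1 := map_mx f A; pose G : 'M[R]_n.+1 := map_mx t A.
have fhomo : {homo f : x y / x <= y}.
  by move=> x y xy; rewrite /f ge_max !le_max lexx orbT lerB.
have thomo : {homo t : x y / x <= y}.
  move=> x y xy; rewrite /t; case: (leP c x) => cx; last by rewrite ler0n.
  by rewrite (le_trans cx xy).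
have ft (x : R) : x = 0 \/ c <= x -> x = f x + c * t x.
  rewrite /f /t; case=> [->|cx].
    by rewrite leNgt c0 /= mulr0 addr0 max_r // sub0r oppr_le0 ltW.
  by rewrite cx mulr1 max_l ?subr_ge0 // subrK.
have Ac i j : A i j = 0 \/ c <= A i j.
  have := Age0 i j; rewrite le_eqVlt => /orP[/eqP ->|Aij]; first by left.
  by right; apply: (p0min (i, j)).
have AE i j : A i j = A' i j + c * G i j by rewrite !mxE; apply: ft.
have f0 : f 0 = 0 by rewrite /f max_r // sub0r oppr_le0 ltW.
have t0 : t 0 = 0 by rewrite /t leNgt c0.
have bA' : \sum_i \sum_j A' i j * q i j <= 2 * row_prefix A'.
  apply: IHm.
  - rewrite -ltnS; apply: leq_trans cA; apply: proper_card; apply/properP; split.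
      apply/fintype.subsetP => r; rewrite !inE mxE /f lt_max ltxx orbF subr_gt0.
      exact: lt_trans.
    by exists p0; rewrite !inE // mxE /f -/c subrr maxxx ltxx.
  - by rewrite /A' map_trmx AT.
  - by move=> i j; rewrite mxE /f le_max lexx orbT.
  - by move=> i; rewrite mxE A0 f0.
have bG : \sum_i \sum_j G i j * q i j <= 2 * row_prefix G.
  apply: zero_one_bound.
  - by rewrite /G map_trmx AT.
  - by move=> i j; rewrite mxE /t; case: (c <= _); [right|left].
  - by move=> i; rewrite mxE A0 t0.
have -> : row_prefix A = row_prefix A' + c * row_prefix G.
  rewrite /row_prefix mulr_sumr -big_split; apply: eq_bigr => i _ /=.
  rewrite (decreasing_row_map (B := A') (A := A) fhomo); last by move=> j _; rewrite mxE.
  rewrite (decreasing_row_map (B := G) (A := A) thomo); last by move=> j _; rewrite mxE.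
  rewrite /prefix_sum mulr_sumr -big_split; apply: eq_bigr => j _ /=.
  (* As k <= n, the prefix never reads the padding. *)
  have js : (j < size (decreasing_row A i))%N.
    by rewrite size_decreasing_row (leq_trans (ltn_ord j)).
  rewrite !(nth_map 0) //; apply: ft.
  by have [l _ ->] := mem_decreasing_row (mem_nth 0 js).
have -> : \sum_i \sum_j A i j * q i j
    = \sum_i \sum_j A' i j * q i j + c * \sum_i \sum_j G i j * q i j.
  rewrite mulr_sumr -big_split; apply: eq_bigr => i _ /=.
  rewrite mulr_sumr -big_split; apply: eq_bigr => j _ /=.
  by rewrite AE; ring.
by nra.
Qed.

(** Subtracting a lower bound [c] from the off-diagonal entries makes them nonnegative. The doubled
    left side drops by 2c(n+1)k by [sum_edge_form], and [row_prefix] by c(n+1)k, so the inequality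
    is unaffected. *)
Theorem laplacian_trace_bound (A : 'M[R]_n.+1) : A^T = A -> (forall i, A i i = 0) ->
  \tr (laplacian A *m Q) <= row_prefix A.
Proof.
move=> AT A0.
have QT : Q^T = Q by case: Qproj.
suff H : \sum_i \sum_j A i j * q i j <= 2 * row_prefix A.
  by have := laplacian_edge_form AT QT; rewrite -/q; lra.
pose c := - \sum_i \sum_j `|A i j|.
have cA i j : c <= A i j.
  rewrite /c lerNl; apply: le_trans (ler_norm _) _; rewrite normrN.
  rewrite (bigD1 i) //= (bigD1 j) //= -addrA lerDl addr_ge0 // sumr_ge0 // => l _.
  by rewrite sumr_ge0.
pose B : 'M[R]_n.+1 := \matrix_(i, j) if i == j then 0 else A i j - c.
have Bb : \sum_i \sum_j B i j * q i j <= 2 * row_prefix B.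
  apply: nonneg_bound.
  - by apply/matrixP => i j; rewrite !mxE eq_sym -[in A j i]AT mxE.
  - by move=> i j; rewrite mxE; case: eqP => // _; rewrite subr_ge0.
  - by move=> i; rewrite mxE eqxx.
have -> : \sum_i \sum_j A i j * q i j
    = \sum_i \sum_j B i j * q i j + c * (2 * n.+1%:R * k%:R).
  rewrite -trQ -sum_edge_form // mulr_sumr -big_split; apply: eq_bigr => i _ /=.
  rewrite mulr_sumr -big_split; apply: eq_bigr => j _ /=; rewrite mxE -/(q i j).
  by have [<-|_] := eqVneq i j; rewrite ?qii; ring.
have -> : row_prefix A = row_prefix B + c * (n.+1%:R * k%:R).
  have -> : c * (n.+1%:R * k%:R) = \sum_(i < n.+1) c * k%:R.
    by rewrite sumr_const card_ord -mulr_natl; ring.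
  rewrite /row_prefix -big_split; apply: eq_bigr => i _ /=.
  rewrite (decreasing_row_map (B := B) (A := A) (f := fun x => x - c)).
  - have -> : c * k%:R = \sum_(j < k) c by rewrite sumr_const card_ord mulr_natr.
    rewrite /prefix_sum -big_split; apply: eq_bigr => j _ /=.
    rewrite (nth_map 0) ?subrK // size_decreasing_row.
    by rewrite (leq_trans (ltn_ord j)).
  - by move=> x y; rewrite lerD2r.
  - by move=> j ji; rewrite mxE eq_sym (negPf ji).
by lra.
Qed.

End Weighted.

(** * Eigenvalues of the Laplacian *)

(** The sizes are kept apart because that of the restricted Laplacian is a rank, only provably equal
    to [n]. *)
Lemma char_poly_similar (F : fieldType) r m (G : 'M[F]_(r, m)) G' (D : 'M[F]_m) :
  G *m G' = 1%:M -> G' *m G = 1%:M -> char_poly (G *m D *m G') = char_poly D.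
Proof.
move=> GG' G'G.
have rm : r = m.
  by apply/anti_leq; rewrite (mulmx1_min GG') (mulmx1_min G'G).
subst r; pose toP := map_mx (@polyC F).
rewrite /char_poly.
have -> : char_poly_mx (G *m D *m G') = toP _ _ G *m char_poly_mx D *m toP _ _ G'.
  rewrite /char_poly_mx mulmxBr mulmxBl mul_mx_scalar -scalemxAl -!map_mxM GG'.
  by rewrite map_scalar_mx scalemx1.
by rewrite det_mulmx mulrC det_mulmx mulrA -det_mulmx -map_mxM G'G map_mx1 det1 mul1r.
Qed.

Section Eigenbasis.
Variables (R : realType).

Lemma eigenvalues_perm m (M : 'M[R]_m) (s : seq R) :
  char_poly M = \prod_(a <- s) ('X - a%:P) -> perm_eq (eigenvalues M) s.
Proof.
move=> Ms; apply/allP => a _ /=.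
by rewrite count_eigenvalues Ms mu_prod_XsubC.
Qed.

(** Complete the normalized all-ones vector to an orthonormal basis and diagonalize the compression
    of the Laplacian to the remaining rows [U]. The third property says that V^T V is the identity
    on zero-sum vectors. *)
Lemma laplacian_eigenbasis n (A : 'M[R]_n.+1) : A^T = A ->
  exists (V : 'M[R]_(n, n.+1)) (d : 'rV[R]_n),
  [/\ V *m V^T = 1%:M, V *m const_mx 1 = 0 :> 'cV_n,
      forall p (X : 'M[R]_(p, n.+1)), X *m const_mx 1 = 0 :> 'cV_p ->
        X *m V^T *m V = X
    & V *m laplacian A = diag_mx d *m V].
Proof.
move=> AT; pose s : R := Num.sqrt n.+1%:R.
have s2 : s ^+ 2 = n.+1%:R by rewrite sqr_sqrtr.
have s0 : s != 0 by rewrite sqrtr_eq0 -ltNge ltr0n.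
pose u : 'rV[R]_n.+1 := const_mx s^-1.
have u1 : u *m u^T = 1%:M.
  apply/matrixP => i j; rewrite !ord1 !mxE.
  under eq_bigr => k _ do rewrite !mxE.
  by rewrite sumr_const card_ord -mulr_natl -s2 eqxx /=; field.
have uE : u^T = s^-1 *: const_mx 1 by apply/matrixP => i j; rewrite !mxE mulr1.
have [O OO rO] := orthogonal_extension u1.
pose U : 'M[R]_(n, n.+1) := dsubmx (O : 'M_(1 + n, n.+1)).
have OE : (O : 'M_(1 + n, n.+1)) = col_mx u U.
  rewrite -[LHS](@vsubmxK _ 1 n) -rO; congr col_mx.
  by apply/rowP => j; rewrite !mxE; congr (O _ _); apply/val_inj.
have : (O : 'M_(1 + n, n.+1)) *m (O : 'M_(1 + n, n.+1))^T = 1%:M by [].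
rewrite OE tr_col_mx mul_col_row u1 scalar_mx_block => /eq_block_mx [_ _ Uu UU].
have : (O : 'M_(1 + n, n.+1))^T *m (O : 'M_(1 + n, n.+1)) = 1%:M.
  exact: (mulmx1C OO).
rewrite OE tr_col_mx mul_row_col => UtU.
have U1 : U *m const_mx 1 = 0 :> 'cV_n.
  have -> : const_mx 1 = s *: u^T by rewrite uE scalerA divff // scale1r.
  by rewrite -scalemxAr Uu scaler0.
have UK p (X : 'M[R]_(p, n.+1)) : X *m const_mx 1 = 0 :> 'cV_p -> X *m U^T *m U = X.
  move=> X1; rewrite -[RHS]mulmx1 -UtU mulmxDr mulmxA uE -scalemxAr X1 scaler0 mul0mx.
  by rewrite add0r mulmxA.
have LT := laplacian_sym AT.
have [|P [d [PP PL]]] := @symmetric_spectral R n (U *m laplacian A *m U^T).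
  by rewrite !trmx_mul trmxK LT mulmxA.
exists (P *m U), d; split.
- by rewrite trmx_mul mulmxA -(mulmxA P) UU mulmx1.
- by rewrite -mulmxA U1 mulmx0.
- move=> p X X1; rewrite trmx_mul !mulmxA -(mulmxA _ P^T) (mulmx1C PP) mulmx1.
  exact: UK.
rewrite mulmxA -PL -!mulmxA; congr (_ *m (_ *m _)).
by rewrite mulmxA UK // laplacian_ones.
Qed.

Lemma char_poly_diag n (d : 'rV[R]_n) :
  char_poly (diag_mx d) = \prod_(a <- [seq d 0 i | i <- enum 'I_n]) ('X - a%:P).
Proof.
rewrite char_poly_trig ?diag_mx_is_trig // big_map big_enum.
by apply: eq_bigr => i _; rewrite mxE eqxx mulr1n.
Qed.

(** [W *m V^T] and [V *m pinvmx W] are inverse changes of basis between [row_base] and the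
    eigenbasis, so the restriction is similar to [diag_mx d]. *)
Lemma laplacian_eigenvalues_perm n (A : 'M[R]_n.+1) (V : 'M[R]_(n, n.+1)) (d : 'rV[R]_n) :
    V *m V^T = 1%:M -> V *m const_mx 1 = 0 :> 'cV_n ->
    (forall p (X : 'M[R]_(p, n.+1)), X *m const_mx 1 = 0 :> 'cV_p ->
        X *m V^T *m V = X) ->
    V *m laplacian A = diag_mx d *m V ->
  perm_eq (laplacian_eigenvalues A) [seq d 0 i | i <- enum 'I_n].
Proof.
move=> VV V1 VK VL; apply: eigenvalues_perm; rewrite -char_poly_diag.
rewrite /conjmx; set W := row_base _.
have W1 : W *m const_mx 1 = 0 :> 'cV_ _.
  by apply/sub_kermxP; rewrite eq_row_base.
have Vsub : (V <= W)%MS by rewrite eq_row_base; apply/sub_kermxP.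
have -> : W *m laplacian A *m pinvmx W
    = (W *m V^T) *m diag_mx d *m (V *m pinvmx W).
  by rewrite -[RHS]mulmxA [diag_mx d *m _]mulmxA -VL !mulmxA VK.
apply: char_poly_similar.
  by rewrite mulmxA VK // mulmxVp // row_base_free.
by rewrite mulmxA mulmxKpV.
Qed.

(** The projection onto the span of the eigenvectors indexed by [s] attains the Ky Fan sum. *)
Lemma eigenrows_projection n (L : 'M[R]_n.+1) (V : 'M[R]_(n, n.+1)) (d : 'rV[R]_n)
    (s : seq 'I_n) :
    V *m V^T = 1%:M -> V *m const_mx 1 = 0 :> 'cV_n ->
    V *m L = diag_mx d *m V -> uniq s ->
  exists Q : 'M[R]_n.+1, [/\ orthoproj Q, Q *m const_mx 1 = 0 :> 'cV_n.+1,
    \tr Q = (size s)%:R & \tr (L *m Q) = \sum_(i <- s) d 0 i].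
Proof.
move=> VV V1 VL us; pose S : 'rV[R]_n := \row_i (i \in s)%:R.
exists (V^T *m diag_mx S *m V).
have sumS (F : 'I_n -> R) : \sum_i F i * (i \in s)%:R = \sum_(i <- s) F i.
  rewrite [RHS]big_uniq //= [RHS]big_mkcond; apply: eq_bigr => i _.
  by case: (i \in s); rewrite ?mulr1 ?mulr0.
split.
- split; first by rewrite !trmx_mul trmxK tr_diag_mx mulmxA.
  rewrite !mulmxA -(mulmxA _ V) VV mulmx1.
  rewrite -(mulmxA V^T (diag_mx S) (diag_mx S)) mulmx_diag.
  congr (_ *m diag_mx _ *m _); apply/rowP => i; rewrite !mxE.
  by case: (i \in s); rewrite ?mulr1 ?mulr0.
- by rewrite -mulmxA V1 mulmx0.
- rewrite -mulmxA mxtrace_mulC -mulmxA VV mulmx1 mxtrace_diag.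
  rewrite (eq_bigr (fun i => 1 * (i \in s)%:R)) => [|i _]; last by rewrite mxE mul1r.
  by rewrite sumS big_const_seq count_predT iter_addr_0.
rewrite mulmxA mxtrace_mulC !mulmxA VL -(mulmxA (diag_mx d)) VV mulmx1 mulmx_diag.
rewrite mxtrace_diag -sumS; apply: eq_bigr => i _.
by rewrite !mxE.
Qed.

Lemma sorted_conjugate_degrees n (A : 'M[R]_n) :
  decreasing_seq (conjugate_degrees A) = conjugate_degrees A.
Proof.
apply: sorted_sort; first by move=> x y z; exact: ge_trans.
apply/(sortedP 0) => i; rewrite size_mkseq => iS.
rewrite !nth_mkseq // ?(ltnW iS) //; apply: ler_sum => j _.
have /(sortedP 0) : sorted >=%R (decreasing_row A j) by exact/sort_sorted/ge_total.
by apply; rewrite size_decreasing_row.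
Qed.

Lemma conjugate_degrees_prefix n (A : 'M[R]_n.+1) k : (k <= n)%N ->
  \sum_(j < k) (conjugate_degrees A)`_j = row_prefix k A.
Proof.
move=> kn; rewrite /row_prefix exchange_big /=; apply: eq_bigr => j _.
by rewrite nth_mkseq // (leq_trans (ltn_ord j)).
Qed.

(** Both sides add up all off-diagonal entries. *)
Lemma row_prefix_full n (A : 'M[R]_n.+1) : (forall i, A i i = 0) ->
  row_prefix n A = \tr (laplacian A).
Proof.
move=> A0; apply: eq_bigr => i _.
rewrite !mxE eqxx mulr1n A0 subr0 (bigD1 i) //= A0 add0r.
transitivity (\sum_(x <- decreasing_row A i) x).
  by rewrite [RHS](big_nth 0) size_decreasing_row big_mkord.
by rewrite (perm_big _ (permEl (perm_sort _ _))) /= big_map big_enum.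
Qed.

End Eigenbasis.

Theorem theorem3p4 (R : realType) (n : nat) (A : 'M[R]_n)
    (A_sym : A^T = A) (A_diag0 : forall i : 'I_n, A i i = 0) :
  majorized (laplacian_eigenvalues A) (conjugate_degrees A).
Proof.
case: n A A_sym A_diag0 => [|n] A A_sym A_diag0.
  (* For order 0 both sequences are empty. *)
  have -> : laplacian_eigenvalues A = [::].
    apply/perm_nilP; apply: eigenvalues_perm; rewrite big_nil.
    move: (restrictmx _ _); have -> : \rank (ones_orth R 0) = 0%N.
      by apply/eqP; rewrite -leqn0 rank_leq_row.
    by move=> M; rewrite /char_poly det_mx00.
  by split=> // k; rewrite /= andbC ltn0.
have [V [d [VV V1 VK VL]]] := laplacian_eigenbasis A_sym.
have permE := laplacian_eigenvalues_perm VV V1 VK VL.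
(* Sorting indices rather than values keeps track of the eigenvectors behind the [k] largest
   eigenvalues. *)
have eigE : decreasing_seq (laplacian_eigenvalues A)
    = [seq d 0 i | i <- sort (relpre (d 0) >=%R) (enum 'I_n)].
  rewrite -sort_map; apply/perm_sortP => //.
  - exact: ge_total.
  - by move=> x y z; exact: ge_trans.
  - by move=> x y; rewrite andbC => /le_anti.
set s := sort _ (enum 'I_n) in eigE.
have us : uniq s by rewrite sort_uniq enum_uniq.
have sz : size s = n by rewrite size_sort size_enum_ord.
have eig_prefix k : (k <= n)%N ->
    \sum_(i < k) (decreasing_seq (laplacian_eigenvalues A))`_i
      = \sum_(i <- take k s) d 0 i.
  move=> kn; rewrite eigE -(big_map (d 0) predT id) map_take.
  rewrite (big_nth 0) big_mkord size_takel ?size_map ?sz //.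
  by apply: eq_bigr => i _; rewrite nth_take.
have sizeE : size (laplacian_eigenvalues A) = n.
  by rewrite (perm_size permE) size_map size_enum_ord.
have sizeC : size (conjugate_degrees A) = n by rewrite size_mkseq.
split; rewrite ?sizeE ?sizeC //.
  move=> k /andP[_ kn]; have {}kn := ltnW kn.
  rewrite eig_prefix // sorted_conjugate_degrees conjugate_degrees_prefix //.
  have [|Q [Qproj Q1 trQ <-]] := eigenrows_projection (s := take k s) VV V1 VL.
    exact: take_uniq.
  rewrite size_takel ?sz // in trQ.
  exact: laplacian_trace_bound.
(* The eigenvalues add up to tr (V L V^T) = tr (L V^T V) = tr L, since L kills the all-ones
   vector. *)
rewrite eig_prefix // sorted_conjugate_degrees conjugate_degrees_prefix //.
rewrite row_prefix_full // take_oversize ?sz // (perm_big _ (permEl (perm_sort _ _))) /=.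
rewrite big_enum -mxtrace_diag -[diag_mx d]mulmx1 -VV mulmxA -VL -mulmxA.
by rewrite mxtrace_mulC VK // laplacian_ones.
Qed.
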